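(* Let $\mu>0$ and let $\nu,\eta$ be reals satisfying $110\nu+250\eta+10\sqrt{\mu}<\frac{1}{2000}$. Let $G$ be an $n$-vertex graph of minimum degree at least $\frac{n}{2}$ with a $\mu n$-bounded incompatibility system $\mathcal{F}$, and suppose there are two sets $A,B\subseteq V(G)$ with $|A|,|B|\ge(\frac12-\nu)n$ and $e(A,B)\le\eta n^2$. Then $G$ contains a Hamilton cycle compatible with $\mathcal{F}$.
   Context: All graphs are finite and simple. For sets of vertices $X,Y$, $e(X,Y)$ is the number of edges with one endpoint in $X$ and the other in $Y$, counted with multiplicity (so $e(X,X)$ is twice the number of edges inside $X$). An incompatibility system $\mathcal{F}$ over $G=(V,E)$ is a family $\{F_v\}_{v\in V}$ where each $F_v$ is a set of unordered pairs $\{e,e'\}$ of distinct edges with $e\cap e'=\{v\}$; edges $e,e'$ are incompatible if $\{e,e'\}\in F_v$ for some $v$, compatible otherwise. A cycle is compatible with $\mathcal{F}$ if every pair of its edges is compatible. For a positive real $\Delta$, $\mathcal{F}$ is $\Delta$-bounded if for every vertex $v$ and edge $e\ni v$, at most $\Delta$ other edges $e'\ni v$ satisfy $\{e,e'\}\in F_v$.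
   Formalization: The graph is assumed to have n ≥ 3 vertices; without this the claim fails for the single edge K_2 (n = 2, A = B = one vertex, ν = η = 0), which meets every hypothesis but has no Hamilton cycle. *)

(* Defs.v *)
From HB Require Import structures.
From mathcomp Require Import all_boot all_order all_algebra.
From mathcomp Require Import reals.
Set Implicit Arguments. Unset Strict Implicit. Unset Printing Implicit Defensive.
Import Order.TTheory GRing.Theory Num.Theory.
Local Open Scope ring_scope.

Definition simple_graph (T : finType) (adj : rel T) : Prop :=
  symmetric adj /\ irreflexive adj.

Definition deg (T : finType) (adj : rel T) (v : T) : nat := #|[set u | adj v u]|.

(* e(X,Y): ordered pairs (x,y), x in X, y in Y, xy an edge
   (so e(X,X) is twice the number of edges inside X). *)
Definition e_between (T : finType) (adj : rel T) (X Y : {set T}) : nat :=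
  \sum_(x in X) \sum_(y in Y) (adj x y : nat).

(* Incompatibility system.  Two distinct edges e,e' with e ∩ e' = {v} are
   exactly {v,x},{v,y} with x <> y; we encode F_v by the relation
   F v x y : "the pair {{v,x},{v,y}} belongs to F_v" (symmetric in x,y). *)
Definition incompat_system (T : finType) (adj : rel T) (F : T -> rel T) : Prop :=
  forall v x y, F v x y ->
    [/\ adj v x, adj v y, x != y & F v y x].

Definition bounded_system (R : realType) (T : finType) (adj : rel T)
    (F : T -> rel T) (Delta : R) : Prop :=
  forall v x, adj v x -> (#|[set y | F v x y]|%:R <= Delta).

Definition cycle_edge (T : finType) (s : seq T) (x y : T) : bool :=
  [&& x \in s, y \in s & (y == next s x) || (x == next s y)].

Definition hamilton_cycle (T : finType) (adj : rel T) (s : seq T) : Prop :=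
  [/\ uniq s, size s = #|T|, (3 <= size s)%N & cycle adj s].

Definition compatible_cycle (T : finType) (F : T -> rel T) (s : seq T) : Prop :=
  forall v x y, cycle_edge s v x -> cycle_edge s v y -> ~~ F v x y.

(* Main.v *)
Require Import Defs.
From HB Require Import structures.
From mathcomp Require Import all_boot all_order all_algebra.
From mathcomp Require Import reals.
From mathcomp Require Import zify lra.
Set Implicit Arguments. Unset Strict Implicit. Unset Printing Implicit Defensive.
Import Order.TTheory GRing.Theory Num.Theory.
Local Open Scope nat_scope.

(** Split V into two classes, either both nearly complete (if A and B are
    nearly disjoint) or spanning a nearly complete bipartite graph (if A and B
    nearly coincide), after moving the few vertices with few neighbours of the
    right kind.  Fix a matching of edges of the wrong kind: two disjoint edges
    between the two near-cliques, respectively |X| - |Y| edges inside the larger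
    class X, obtained greedily after moving some vertices from X to Y.  Among
    the cyclic orderings of V all of whose steps are of the right kind or in the
    matching, choose one minimising the number of non-edges plus incompatible
    consecutive pairs.  If there is a defect, some step (a, a') of the right
    kind takes part in it.  Pick w adjacent to a and w' adjacent to a', move
    both between a and a', and close the gaps left behind by joining the
    predecessors of w and w' to each other, and likewise the successors.  Every
    new edge or new pair of consecutive edges involves w and w' generically, so
    it fails for few pairs (w, w'), and a pair that never fails decreases the
    number of defects.  If mu n < 1 nothing is incompatible and Dirac's theorem
    applies. *)

(** * Costs of cyclic orderings *)

Section TripleCost.
Variables (T : eqType) (c : T -> T -> T -> nat).

Fixpoint triple_cost (s : seq T) : nat :=
  if s is x :: s1 then
    (if s1 is y :: z :: _ then c x y z else 0) + triple_cost s1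
  else 0.

(** Repeating the first two entries closes the cycle: in a list of at least two entries every
    position is then the middle of exactly one triple. *)
Definition cyclic_cost (s : seq T) : nat := triple_cost (s ++ take 2 s).

(** The two pieces overlap in two entries so that each triple lies in exactly one of them. *)
Lemma triple_cost_cat s1 x y s2 :
  triple_cost (s1 ++ x :: y :: s2) =
  triple_cost (s1 ++ [:: x; y]) + triple_cost (x :: y :: s2).
Proof.
elim: s1 => [|u s1 IH] //.
rewrite !cat_cons [LHS]/= IH [triple_cost (u :: _)]/= -addnA; congr (_ + _).
by case: s1 {IH} => [|v [|w s1]].
Qed.

Lemma triple_cost_join s1 x y z w s2 :
  triple_cost (s1 ++ x :: y :: z :: w :: s2) =
  triple_cost (s1 ++ [:: x; y]) + c x y z + c y z w
  + triple_cost (z :: w :: s2).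
Proof. by rewrite triple_cost_cat /=; lia. Qed.

Lemma triple_cost_join1 s1 x y p z w s2 :
  triple_cost (s1 ++ x :: y :: p :: z :: w :: s2) =
  triple_cost (s1 ++ [:: x; y]) + c x y p + c y p z + c p z w
  + triple_cost (z :: w :: s2).
Proof. by rewrite triple_cost_cat /=; lia. Qed.

Lemma triple_cost_join2 s1 x y p q z w s2 :
  triple_cost (s1 ++ x :: y :: p :: q :: z :: w :: s2) =
  triple_cost (s1 ++ [:: x; y]) + c x y p + c y p q + c p q z + c q z w
  + triple_cost (z :: w :: s2).
Proof. by rewrite triple_cost_cat /=; lia. Qed.

Hypothesis c_sym : forall x y z, c x y z = c z y x.

Lemma triple_cost_rev s : triple_cost (rev s) = triple_cost s.
Proof.
elim: s => [|x [|y [|z s]] IH] //.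
have -> : rev [:: x, y, z & s] = rev s ++ [:: z; y; x].
  by rewrite 3!rev_cons -!cats1 -!catA.
have E : rev [:: y, z & s] = rev s ++ [:: z; y].
  by rewrite 2!rev_cons -!cats1 -!catA.
rewrite triple_cost_cat -E IH [RHS]/= c_sym /=; lia.
Qed.

Lemma cyclic_cost_rot s k : 2 < size s -> cyclic_cost (rot k s) = cyclic_cost s.
Proof.
move=> s2; have rot1 r : 2 < size r -> cyclic_cost (rot 1 r) = cyclic_cost r.
  case: r => [|x [|y [|z r]]] // _.
  have -> : cyclic_cost (rot 1 [:: x, y, z & r]) =
      triple_cost ((y :: z :: r) ++ [:: x, y & [:: z]]).
    by rewrite rot1_cons /cyclic_cost -cats1 /= take0 -!catA.
  by rewrite triple_cost_cat /cyclic_cost /= ?take0; lia.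
elim: k => [|k IH]; first by rewrite rot0.
case: (ltnP k (size s)) => ks; last by rewrite rot_oversize // ltnW.
by rewrite rotS // rot1 // size_rot.
Qed.

Lemma cyclic_cost_rev s : 2 < size s -> cyclic_cost (rev s) = cyclic_cost s.
Proof.
case: s => [|x [|y s]] // s2.
have -> : rev (x :: y :: s) = rot 2 (y :: x :: rev s).
  by rewrite 2!rev_cons -!cats1 -!catA /rot /= take0 drop0.
rewrite cyclic_cost_rot; last by rewrite /= size_rev.
have -> : cyclic_cost [:: y, x & rev s] = triple_cost (rev ([:: x, y & s] ++ [:: x; y])).
  have R : rev [:: x; y] = [:: y; x] by [].
  by rewrite rev_cat R 2!rev_cons -!cats1 /cyclic_cost /= take0 -!catA.
by rewrite triple_cost_rev /cyclic_cost /= take0.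
Qed.

Lemma triple_cost_gt0 s : 0 < triple_cost s ->
  exists s1 x y z s2, s = s1 ++ [:: x, y, z & s2] /\ 0 < c x y z.
Proof.
elim: s => [|x [|y [|z s]] IH] //.
rewrite [triple_cost _]/= addn_gt0 => /orP[h|/IH[s1 [a [b [d [s2 [-> h]]]]]]].
  by exists [::], x, y, z, s.
by exists (x :: s1), a, b, d, s2.
Qed.

Lemma cyclic_cost_gt0 s : 2 < size s -> 0 < cyclic_cost s ->
  exists k x y z t, rot k s = [:: x, y, z & t] /\ 0 < c x y z.
Proof.
move=> s2 /triple_cost_gt0[w1 [x [y [z [w2 [E h]]]]]].
have [k Ek] : exists k t, rot k s = [:: x, y, z & t]; last first.
  by case: Ek => t Et; exists k, x, y, z, t.
exists (size w1).
have s3 : size (take 2 s) = 2 by rewrite size_take s2.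
have sz := congr1 size E; rewrite !size_cat s3 /= in sz.
have split w r : w1 ++ [:: x, y, z & w2] = (w1 ++ w) ++ r -> size r = 2 ->
    s = w1 ++ w /\ take 2 s = r.
  rewrite -E => E' r2; have /eqP := E'; rewrite eqseq_cat.
    by move=> /andP[/eqP-> /eqP->].
  by have := congr1 size E'; rewrite !size_cat s3 r2 => /addIn.
(* The appended [take 2 s] has two entries, so the triple wraps around exactly when [w2] has fewer
   than two; otherwise it lies inside [s], and the last two entries after it are split off. *)
case: w2 E sz split => [|e [|f w2]] E sz split.
- have [|//|E1 E2] := split [:: x] [:: y; z]; first by rewrite -catA.
  rewrite {1}E1 rot_size_cat; case: w1 E1 {E split sz} => [|a [|b w1]] E1;
    rewrite {}E1 // in s2 E2 *.
  by move: E2; rewrite /= take0 => -[-> ->]; exists w1.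
- have [|//|E1 E2] := split [:: x; y] [:: z; e]; first by rewrite -catA.
  rewrite {1}E1 rot_size_cat; case: w1 E1 {E split sz} => [|a w1] E1;
    rewrite {}E1 // in s2 E2 *.
  by move: E2; rewrite /= => -[-> _]; exists w1.
elim/last_ind: w2 E sz split => [|w2 b _] E sz split.
  have [|//|E1 E2] := split [:: x; y; z] [:: e; f]; first by rewrite -catA.
  by rewrite {1}E1 rot_size_cat; exists w1.
elim/last_ind: w2 E sz split => [|w2 a _] E sz split.
  have [|//|E1 E2] := split [:: x; y; z; e] [:: f; b]; first by rewrite -catA.
  by rewrite {1}E1 rot_size_cat; exists (e :: w1).
have [||E1 E2] := split [:: x, y, z, e, f & w2] [:: a; b] => //.
  by rewrite -!cats1 -!catA.
by rewrite {1}E1 rot_size_cat; exists (e :: f :: w2 ++ w1).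
Qed.

Lemma next_cat (s1 s2 : seq T) x y :
  uniq (s1 ++ [:: x, y & s2]) -> next (s1 ++ [:: x, y & s2]) x = y.
Proof.
move=> us; rewrite -(next_rot (size s1) us) rot_size_cat /=.
by rewrite eqxx.
Qed.

Lemma prev_cat (s1 s2 : seq T) x y :
  uniq (s1 ++ [:: x, y & s2]) -> prev (s1 ++ [:: x, y & s2]) y = x.
Proof. by move=> us; rewrite -{2}(next_cat us) prev_next. Qed.

Lemma cyclic_cost_eq0P s : uniq s -> 2 < size s ->
  cyclic_cost s = 0 <-> {in s, forall v, c (prev s v) v (next s v) = 0}.
Proof.
move=> us s2; split=> [c0 v vs | h].
  have [i r Er] : rot_to_spec s (prev s v) by apply: rot_to; rewrite mem_prev.
  have ur : uniq (rot i s) by rewrite rot_uniq.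
  have := cyclic_cost_rot i s2; rewrite c0 => /eqP.
  have nE := next_prev us v; rewrite -(next_rot i us) in nE.
  rewrite -(next_rot i us v); move: ur nE; have := s2; rewrite -(size_rot i) Er.
  case: r {Er} => [|w [|e r]] // _ ur.
  rewrite (@next_cat [::] _ _ _ ur) => wv; subst w.
  rewrite (@next_cat [:: prev s v] _ _ _ ur).
  by rewrite /cyclic_cost /= !addn_eq0 => /andP[/eqP].
apply/eqP; rewrite -leqn0 leqNgt; apply/negP => /(cyclic_cost_gt0 s2).
move=> [k [x [y [z [t [E]]]]]]; apply/negP; rewrite -leqNgt leqn0.
have ur : uniq (rot k s) by rewrite rot_uniq.
have ys : y \in s by rewrite -(mem_rot k) E !inE eqxx orbT.
have := h y ys; rewrite -(next_rot k us) -(prev_rot k us); rewrite E in ur *.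
by rewrite (@next_cat [:: x] _ _ _ ur) (@prev_cat [::] _ _ _ ur) => ->.
Qed.

(** Only triples straddling a junction change, so each segment is displayed by its first two and
    last two entries. The inner triples, collected in [t], survive, those of [S2] in reverse. *)
Lemma cyclic_cost_switch a' b1 m1 u1 u p v v1 m2 r1 r q z z1 m3 a1 a x y :
  let S1 := [:: a', b1 & m1 ++ [:: u1; u]] in
  let S2 := [:: v, v1 & m2 ++ [:: r1; r]] in
  let S3 := [:: z, z1 & m3 ++ [:: a1; a]] in
  let t := triple_cost S1 + triple_cost S2 + triple_cost S3 in
  cyclic_cost (S1 ++ p :: S2 ++ q :: S3) =
    t + c u1 u p + c u p v + c p v v1 + c r1 r q + c r q z + c q z z1
    + c a1 a a' + c a a' b1
  /\ cyclic_cost (S3 ++ [:: x, y & S1] ++ rev S2) =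
    t + c a1 a x + c a x y + c x y a' + c y a' b1 + c u1 u r + c u r r1
    + c v1 v z + c v z z1.
Proof.
move=> S1 S2 S3 t; rewrite {}/t; split.
  have -> : cyclic_cost (S1 ++ p :: S2 ++ q :: S3) = triple_cost
      ([:: a', b1 & m1] ++ [:: u1, u, p, v, v1 & m2 ++
         [:: r1, r, q, z, z1 & m3 ++ [:: a1; a; a'; b1]]]).
    by rewrite /cyclic_cost /S1 /S2 /S3 /= take0 -!catA /= -!catA /= -!catA.
  rewrite triple_cost_join1 -[[:: v, v1 & _]]/([:: v, v1 & m2] ++
    [:: r1, r, q, z, z1 & m3 ++ [:: a1; a; a'; b1]]).
  rewrite triple_cost_join1 -[[:: z, z1 & _]]/([:: z, z1 & m3] ++ [:: a1, a, a', b1 & [::]]).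
  by rewrite triple_cost_join /S1 /S2 /S3 /=; lia.
have R2 : rev S2 = [:: r, r1 & rev m2 ++ [:: v1; v]].
  by rewrite /S2 -[m2 ++ _](cat_rcons r1 m2 [:: r]) cats1 !rev_cons !rev_rcons /= -!cats1 -!catA.
rewrite -(triple_cost_rev S2) R2.
have -> : cyclic_cost (S3 ++ [:: x, y & S1] ++ [:: r, r1 & rev m2 ++ [:: v1; v]]) = triple_cost
    ([:: z, z1 & m3] ++ [:: a1, a, x, y, a', b1 & m1 ++
       [:: u1, u, r, r1 & rev m2 ++ [:: v1, v, z, z1 & [::]]]]).
  by rewrite /cyclic_cost /S1 /S3 /= take0 -!catA /= -!catA /= -!catA.
rewrite triple_cost_join2 -[[:: a', b1 & _]]/([:: a', b1 & m1] ++
  [:: u1, u, r, r1 & rev m2 ++ [:: v1, v, z, z1 & [::]]]).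
rewrite triple_cost_join -[[:: r, r1 & _]]/([:: r, r1 & rev m2] ++ [:: v1, v, z, z1 & [::]]).
by rewrite triple_cost_join /S1 /S3 /=; lia.
Qed.
End TripleCost.

Lemma seq_ends (T : Type) (S : seq T) : 3 < size S ->
  exists x y m z t, S = [:: x, y & m ++ [:: z; t]].
Proof.
case: S => [|x [|y S]] //; case/lastP: S => [|S t] //; case/lastP: S => [|S z] // _.
by exists x, y, S, z, t; rewrite -!cats1 -catA.
Qed.

Lemma split_two (T : eqType) (s : seq T) p q :
  p \in s -> q \in s -> index p s < index q s ->
  exists S1 S2 S3, [/\ s = S1 ++ p :: S2 ++ q :: S3, size S1 = index p s,
    size S2 = index q s - (index p s).+1 & size S3 = size s - (index q s).+1].
Proof.
move=> ps qs pq.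
have szp : index p s < size s by rewrite index_mem.
have szq : index q s < size s by rewrite index_mem.
exists (take (index p s) s), (take (index q s - (index p s).+1) (drop (index p s).+1 s)),
  (drop (index q s).+1 s); split.
- have Eq : drop (index p s).+1 s =
    take (index q s - (index p s).+1) (drop (index p s).+1 s) ++ q :: drop (index q s).+1 s.
    rewrite -{1}(cat_take_drop (index q s - (index p s).+1) (drop (index p s).+1 s)).
    by rewrite drop_drop subnK // (drop_nth p szq) nth_index.
  by rewrite -Eq -{1}(cat_take_drop (index p s) s) (drop_nth p szp) nth_index.
- by rewrite size_take szp.
- by rewrite size_takel // size_drop; lia.
- by rewrite size_drop.
Qed.

(* The rearrangement: [s], read cyclically as S1 p S2 q S3 with S1 starting
   at [a'] and S3 ending at [a], becomes S3 w w' S1 rev(S2) with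
   {p, q} = {w, w'}; whatever the order of w and w' in [s], the junctions
   between the segments join (P w, P w') and (N w, N w'). *)
Lemma cyclic_cost_splice (T : eqType) (s m : seq T) a a' w w' (P := prev s) (N := next s) :
  uniq s -> s = a' :: rcons m a -> w \in s -> w' \in s ->
  3 < index w s -> index w s + 4 < size s ->
  3 < index w' s -> index w' s + 4 < size s ->
  (index w s + 4 < index w' s) || (index w' s + 4 < index w s) ->
  exists2 s', perm_eq s' s & forall c : T -> T -> T -> nat,
    (forall x y z, c x y z = c z y x) ->
    c a w w' <= c (P w) w (N w) -> c w w' a' <= c (P w') w' (N w') ->
    c w' a' (N a') <= c a a' (N a') ->
    c (P (P w)) (P w) (P w') <= c (P (P w)) (P w) w ->
    c (P (P w')) (P w') (P w) <= c (P (P w')) (P w') w' ->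
    c (N (N w)) (N w) (N w') <= c (N (N w)) (N w) w ->
    c (N (N w')) (N w') (N w) <= c (N (N w')) (N w') w' ->
    cyclic_cost c s' + c (P a) a a' <= cyclic_cost c s + c (P a) a w.
Proof.
move=> us sE ws w's i1 i2 j1 j2 ij.
(* [p] is whichever of [w] and [w'] comes first in [s]. *)
have [p [q [pq ps qs E]]] : exists p q, [/\ index p s + 4 < index q s, p \in s, q \in s &
   (p, q) = (w, w') \/ (p, q) = (w', w)].
  by case/orP: ij => h; [exists w, w' | exists w', w]; split; auto.
have [p4 q4] : 3 < index p s /\ index q s + 4 < size s by case: E => -[-> ->].
have [|S1 [S2 [S3 [sD z1 z2 z3]]]] := split_two ps qs; first lia.
have [|x [b1 [m1 [u1 [u D1]]]]] := @seq_ends _ S1; first lia.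
have [|v [v1 [m2 [r1 [r D2]]]]] := @seq_ends _ S2; first lia.
have [|z [y1 [m3 [a1 [a2 D3]]]]] := @seq_ends _ S3; first lia.
have xE : x = a' by have := congr1 (head x) sE; rewrite sD D1.
have aE : a2 = a.
  have := congr1 (last x) sE; rewrite sD D3 /= last_rcons last_cat /= last_cat /=.
  by rewrite last_cat.
subst x a2.
have nx l1 l2 g h : s = l1 ++ [:: g, h & l2] -> N g = h.
  by move=> sl; rewrite /N sl; apply: next_cat; rewrite -sl.
have px l1 l2 g h : s = l1 ++ [:: g, h & l2] -> P h = g.
  by move=> sl; rewrite /P sl; apply: prev_cat; rewrite -sl.
have sD' : s = S1 ++ p :: S2 ++ q :: S3 by [].
rewrite D1 D2 D3 /= -?catA /= -?catA /= -?catA /= in sD.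
have Pp : P p = u by apply: (px ([:: a', b1 & m1] ++ [:: u1])); rewrite sD -?catA.
have Pu : P u = u1 by apply: (px [:: a', b1 & m1]); rewrite sD.
have Np : N p = v by apply: (nx ([:: a', b1 & m1] ++ [:: u1; u])); rewrite sD -?catA.
have Nv : N v = v1 by apply: (nx ([:: a', b1 & m1] ++ [:: u1; u; p])); rewrite sD -?catA.
pose l := [:: a', b1 & m1] ++ [:: u1, u, p, v, v1 & m2].
have Pr : P r = r1 by apply: (px l); rewrite sD -?catA.
have Pq : P q = r by apply: (px (l ++ [:: r1])); rewrite sD -?catA /= -?catA.
have Nq : N q = z by apply: (nx (l ++ [:: r1; r])); rewrite sD -?catA /= -?catA.
have Nz : N z = y1 by apply: (nx (l ++ [:: r1; r; q])); rewrite sD -?catA /= -?catA.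
have Pa : P a = a1.
  by apply: (px (l ++ [:: r1, r, q, z, y1 & m3])); rewrite sD -?catA /= -?catA.
have Na' : N a' = b1 by apply: (nx [::]); rewrite sD.
exists (S3 ++ [:: w, w' & S1] ++ rev S2).
  rewrite sD'; apply/permP => f; rewrite !count_cat /= !count_cat /= count_rev.
  by case: E => -[-> ->]; lia.
move=> c c_sym; have := cyclic_cost_switch c_sym a' b1 m1 u1 u p v v1 m2 r1 r q z y1 m3 a1 a w w'.
rewrite -D1 -D2 -D3; cbv zeta; rewrite -sD' => -[-> ->]; rewrite Pa Na'.
(* The hypotheses read the triples at the new junctions in a fixed direction; these four triples
   have to be reversed to match them. *)
have h1 := c_sym u r r1; have h2 := c_sym v z y1.
have h3 := c_sym p v v1; have h4 := c_sym q z y1.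
by case: E => -[? ?]; subst p q; rewrite Pp Pu Pq Pr Np Nq Nv Nz; lia.
Qed.

(** * Removing defects *)

Lemma card_pairsE (T : finType) (Q : T -> T -> bool) :
  #|[set e : T * T | Q e.1 e.2]| = \sum_x #|[set y | Q x y]|.
Proof.
rewrite -sum1dep_card -(pair_big_dep xpredT Q (fun _ _ => 1)) /=.
by apply: eq_bigr => x _; rewrite sum1dep_card.
Qed.

Lemma card_pairs_row (T : finType) (Q : T -> T -> bool) m :
  (forall x, #|[set y | Q x y]| <= m) ->
  #|[set e : T * T | Q e.1 e.2]| <= #|T| * m.
Proof.
by move=> Qm; rewrite card_pairsE -sum_nat_const; apply: leq_sum => x _; apply: Qm.
Qed.

Lemma card_pairs_col (T : finType) (Q : T -> T -> bool) m :
  (forall y, #|[set x | Q x y]| <= m) ->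
  #|[set e : T * T | Q e.1 e.2]| <= #|T| * m.
Proof.
move=> /card_pairs_row; apply: leq_trans.
pose sw (e : T * T) := (e.2, e.1).
have sw_inj : injective sw by move=> [x y] [z t] [-> ->].
rewrite -(card_imset _ sw_inj); apply: subset_leq_card.
by apply/subsetP => e /imsetP[f + ->]; rewrite !inE.
Qed.

(** Union bound: it supplies the generic pair that avoids all bad events at once. *)
Lemma exists_outside (U : finType) (A : {set U}) (Bs : seq {set U}) :
  sumn [seq #|B : {set U}| | B <- Bs] < #|A| ->
  exists2 x, x \in A & all (fun B : {set U} => x \notin B) Bs.
Proof.
elim: Bs A => [|B Bs IH] A /=; first by case/card_gt0P => x; exists x.
move=> lt; have [|x] := IH (A :\: B).
  by have := cardsID B A; have := subset_leq_card (subsetIr A B); lia.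
by rewrite inE => /andP[xB xA] xBs; exists x => //; rewrite xB.
Qed.

Lemma card_index_mem (T : finType) (s : seq T) (L : seq nat) :
  (forall x, x \in s) -> #|[set x | index x s \in L]| <= size L.
Proof.
move=> sT; case: (pickP (@predT T)) => [x0 _|T0]; last first.
  by rewrite (_ : [set _ | _] = set0) ?cards0 //; apply/setP => x; have := T0 x.
rewrite -(size_map (nth x0 s)); apply: leq_trans (card_size _).
apply: subset_leq_card; apply/subsetP => x; rewrite inE => xL.
by apply/mapP; exists (index x s) => //; rewrite nth_index.
Qed.

(** Steps of the right kind, for both extremal structures at once: [b = true] asks for opposite
    sides (nearly bipartite), [b = false] for equal sides (two near-cliques). *)
Definition good (T : Type) (side : T -> bool) (b : bool) : rel T :=
  fun x y => (side x (+) side y) == b.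

(** Each step is charged in both triples containing it; for symmetric [t] this makes the cost
    invariant under reversal of the triple. *)
Definition pair_cost (T : Type) (t : rel T) (x y z : T) : nat := ~~ t x y + ~~ t y z.

Definition incompat_cost (T : Type) (adj : rel T) (F : T -> rel T) (x y z : T) : nat :=
  pair_cost adj x y z + F y x z.

Lemma cyclic_cost_pair (T : eqType) (t : rel T) (s : seq T) :
  uniq s -> 2 < size s -> cycle t s <-> cyclic_cost (pair_cost t) s = 0.
Proof.
move=> us s2; rewrite cyclic_cost_eq0P //; split=> [cs v vs | h].
  by rewrite /pair_cost (prev_cycle cs vs) (next_cycle cs vs).
apply: cycle_from_next => // x xs; have /eqP := h x xs.
by rewrite addn_eq0 !eqb0 !negbK => /andP[].
Qed.

Section Core.
Variables (T : finType) (adj M : rel T) (F : T -> rel T) (side : T -> bool) (b : bool).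
Variables (K N0 D : nat).
Hypothesis adj_sym : symmetric adj.
Hypothesis F_sym : forall v x y, F v x y = F v y x.
Hypothesis F_bound : forall v x, #|[set y | F v x y]| <= D.
Hypothesis M_sym : symmetric M.
Hypothesis M_adj : subrel M adj.
Hypothesis M_matching : forall x y z, M x y -> M x z -> y = z.
Let g := good side b.
Let t x y := g x y || M x y.
Hypothesis nonadj_bound : #|[set e : T * T | g e.1 e.2 && ~~ adj e.1 e.2]| <= N0.
Hypothesis deg_bound : forall v,
  K <= #|[set u | [&& adj v u, g v u & [forall z, ~~ M u z]]]|.
Hypothesis T_gt2 : 2 < #|T|.
(* Choosing (w, w') generically: 3 new edges joining a w-vertex to a w'-vertex
   must be present, 8 new pairs of edges must be compatible, and 8 + 8 + 9
   positions keep w and w' away from a, a' and from each other. *)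
Hypothesis K_large : 3 * N0 + 8 * (#|T| * D) + 25 * #|T| < K * K.

Let g_sym : symmetric g.
Proof. by move=> x y; rewrite /g /good addbC. Qed.

(** The side changes by [b (+) b (+) b = b] along three right steps. The joins created by a splice
    always close such a path, whichever value [b] has. *)
Let g_path3 x y z u : g x y -> g y z -> g z u -> g x u.
Proof.
by rewrite /g /good; case: (side x) (side y) (side z) (side u) b => [] [] [] [] [].
Qed.

Let t_sym : symmetric t.
Proof. by move=> x y; rewrite /t g_sym M_sym. Qed.

Let K_le (v : T) : K <= #|T|.
Proof. by apply: leq_trans (deg_bound v) (max_card _). Qed.

(** One local improvement. The list is rotated so that the right step taking part in the defect is
    the closing one, from the last entry [a] to the first entry [a']; a defect at the other end of
    the step is reached by reversing the list. *)
Lemma cost_decrease s m a a' : uniq s -> size s = #|T| -> s = a' :: rcons m a ->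
  cycle t s -> g a a' -> ~~ adj a a' || F a (prev s a) a' ->
  exists s', [/\ uniq s', size s' = #|T|, cycle t s' &
    cyclic_cost (incompat_cost adj F) s' < cyclic_cost (incompat_cost adj F) s].
Proof.
move=> us sT sE cs ga bad.
have n25 : 25 < #|T| by have := K_le a; nia.
have sall x : x \in s.
  suff -> : s =i predT by [].
  by apply/subset_cardP; [rewrite (card_uniqP us) sT | apply/subsetP].
set P := prev s in bad *; pose N := next s.
have Pinj : injective P := can_inj (next_prev us).
have Ninj : injective N := can_inj (prev_next us).
(* Choosing [w] and [w'] off the matching makes both steps of [s] at each of them right steps. *)
pose Q x := [forall z, ~~ M x z].
pose A := setX [set u | [&& adj a u, g a u & Q u]] [set u | [&& adj a' u, g a' u & Q u]].
pose L := iota 0 4 ++ iota (#|T| - 4) 4.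
(* In order: the three new joins that may be missing, the eight new pairs of edges that may be
   incompatible, and the positions to avoid. The window of nine around [index e.1 s] is truncated
   only for positions below 4, which [L] already excludes. *)
pose Bs : seq {set T * T} := [::
  [set e | g e.1 e.2 && ~~ adj e.1 e.2];
  [set e | g (P e.1) (P e.2) && ~~ adj (P e.1) (P e.2)];
  [set e | g (N e.1) (N e.2) && ~~ adj (N e.1) (N e.2)];
  [set e | F a (P a) e.1];
  [set e | F a' (N a') e.2];
  [set e | F e.1 a e.2];
  [set e | F e.2 a' e.1];
  [set e | F (P e.1) (P (P e.1)) (P e.2)];
  [set e | F (P e.2) (P (P e.2)) (P e.1)];
  [set e | F (N e.1) (N (N e.1)) (N e.2)];
  [set e | F (N e.2) (N (N e.2)) (N e.1)];
  [set e | index e.1 s \in L];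
  [set e | index e.2 s \in L];
  [set e | index e.2 s \in iota (index e.1 s - 4) 9]].
have F_inj (f : T -> T) v x : injective f -> #|[set y | F v x (f y)]| <= D.
  move=> fi; apply: leq_trans (F_bound v x); rewrite -(card_preimset [set y | F v x y] fi).
  by apply: subset_leq_card; apply/subsetP => y; rewrite !inE.
have N_inj (f : T -> T) : injective f ->
    #|[set e : T * T | g (f e.1) (f e.2) && ~~ adj (f e.1) (f e.2)]| <= N0.
  move=> fi; apply: leq_trans nonadj_bound.
  have fi2 : injective (fun e : T * T => (f e.1, f e.2)).
    by move=> [x y] [z u] /= [/fi-> /fi->].
  rewrite -(card_preimset [set e : T * T | g e.1 e.2 && ~~ adj e.1 e.2] fi2); apply: subset_leq_card.
  by apply/subsetP => y; rewrite !inE.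
have Lsz : size L = 8 by rewrite size_cat !size_iota.
have [|[w w'] wA wBs] := @exists_outside _ A Bs.
  have KA : K * K <= #|A| by rewrite cardsX leq_mul // deg_bound.
  apply: leq_trans KA; apply: leq_ltn_trans K_large.
  rewrite /Bs /=.
  have h1 := N_inj id (@inj_id T); have h2 := N_inj P Pinj; have h3 := N_inj N Ninj.
  have h4 := @card_pairs_col T (fun x _ => F a (P a) x) D (fun _ => F_bound _ _).
  have h5 := @card_pairs_row T (fun _ x => F a' (N a') x) D (fun _ => F_bound _ _).
  have h6 := @card_pairs_row T (fun x y => F x a y) D (fun _ => F_bound _ _).
  have h7 := @card_pairs_col T (fun x y => F y a' x) D (fun _ => F_bound _ _).
  have h8 := @card_pairs_row T (fun x y => F (P x) (P (P x)) (P y)) D (fun _ => F_inj _ _ _ Pinj).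
  have h9 := @card_pairs_col T (fun x y => F (P y) (P (P y)) (P x)) D (fun _ => F_inj _ _ _ Pinj).
  have h10 := @card_pairs_row T (fun x y => F (N x) (N (N x)) (N y)) D (fun _ => F_inj _ _ _ Ninj).
  have h11 := @card_pairs_col T (fun x y => F (N y) (N (N y)) (N x)) D (fun _ => F_inj _ _ _ Ninj).
  have h12 := @card_pairs_col T (fun x _ => index x s \in L) _ (fun _ => card_index_mem _ sall).
  have h13 := @card_pairs_row T (fun _ x => index x s \in L) _ (fun _ => card_index_mem _ sall).
  have h14 := @card_pairs_row T (fun x y => index y s \in iota (index x s - 4) 9) 9
    (fun x => card_index_mem (iota (index x s - 4) 9) sall).
  rewrite Lsz in h12 h13.
  rewrite /= in h1 h2 h3 h4 h5 h6 h7 h8 h9 h10 h11 h12 h13 h14.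
  lia.
move: wA; rewrite !inE /= => /andP[/and3P[aw gw Qw] /and3P[aw' gw' Qw']].
case/and5P: wBs => n1 n2 n3 f1 /and5P[f2 f3 f4 f5 /and5P[f6 f7 f8 i1 /and3P[i2 i12 _]]].
rewrite !inE /= in n1 n2 n3 f1 f2 f3 f4 f5 f6 f7 f8.
rewrite in_set mem_cat !mem_iota /= in i1; rewrite in_set mem_cat !mem_iota /= in i2.
rewrite in_set mem_iota /= in i12.
(* The path of right steps is [w], [a], [a'], [w']; the joins of predecessors and of successors then
   follow along paths through [w] and [w']. *)
have gww : g w w' by apply: (g_path3 (y := a) (z := a')); rewrite // g_sym.
have gPN x : Q x -> g (P x) x && g x (N x).
  move=> /forallP Qx; have := prev_cycle cs (sall x); have := next_cycle cs (sall x).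
  rewrite /t (M_sym (prev s x)) -/(P x) -/(N x).
  by rewrite (negbTE (Qx (P x))) (negbTE (Qx (N x))) !orbF => -> ->.
have /andP[gPw gNw] := gPN _ Qw; have /andP[gPw' gNw'] := gPN _ Qw'.
have gP : g (P w) (P w') by apply: g_path3 gPw gww _; rewrite g_sym.
have gN : g (N w) (N w') by apply: g_path3 gww gNw'; rewrite g_sym.
rewrite gww negbK /= in n1; rewrite gP negbK /= in n2; rewrite gN negbK /= in n3.
have wi : index w s < size s by rewrite index_mem.
have w'i : index w' s < size s by rewrite index_mem.
have arith n k : 25 < n -> ~~ ((k < 0 + 4) || (n - 4 <= k < n - 4 + 4)) -> k < n ->
  3 < k /\ k + 4 < n by clear; lia.
rewrite sT in wi w'i; have [w3 w4] := arith _ _ n25 i1 wi; have [w'3 w'4] := arith _ _ n25 i2 w'i.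
have ww' : (index w s + 4 < index w' s) || (index w' s + 4 < index w s).
  by clear -i12 w3 w'3; lia.
rewrite -sT in w4 w'4.
have [s' s's h] := cyclic_cost_splice us sE (sall w) (sall w') w3 w4 w'3 w'4 ww'.
have us' : uniq s' by rewrite (perm_uniq s's).
have sT' : size s' = #|T| by rewrite (perm_size s's).
have t_good x y : g x y -> t x y by rewrite /t => ->.
have s2 : 2 < size s by rewrite sT.
have s2' : 2 < size s' by rewrite sT'.
exists s'; split => //.
  (* The splice estimate is used twice: with [pair_cost t], whose old value is 0, to see that all
     steps remain admissible, and then with [incompat_cost] to get the decrease. *)
  rewrite (cyclic_cost_pair _ us') //; apply/eqP; rewrite -leqn0.
  have c0 : cyclic_cost (pair_cost t) s = 0 by apply/cyclic_cost_pair.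
  have := h (pair_cost t); rewrite c0 add0n => hT.
  have : cyclic_cost (pair_cost t) s' + pair_cost t (P a) a a' <= pair_cost t (P a) a w.
    have ta : t w' a' by rewrite t_good // g_sym.
    have tP : t (P w') (P w) by rewrite t_good // g_sym.
    have tN : t (N w') (N w) by rewrite t_good // g_sym.
    have [t1 t2] := (t_good _ _ gw, t_good _ _ gww).
    have [t3 t4] := (t_good _ _ gP, t_good _ _ gN).
    apply: hT; rewrite /pair_cost -/P -/N ?ta ?tP ?tN ?t1 ?t2 ?t3 ?t4 /=
      ?addn0 ?add0n ?leq_addr ?leq_addl //.
    by move=> x y z; rewrite addnC (t_sym z y) (t_sym y x).
  rewrite /pair_cost (t_good _ _ gw) /= addn0 addnCA -[X in _ <= X]addn0 leq_add2l leqn0 addn_eq0.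
  by case/andP => /eqP ->.
have := h (incompat_cost adj F).
have zl x y z : adj x y -> adj y z -> ~~ F y x z -> incompat_cost adj F x y z = 0.
  by rewrite /incompat_cost /pair_cost => -> -> /negbTE ->.
have le x y z u : adj y z -> ~~ F y x z ->
    incompat_cost adj F x y z <= incompat_cost adj F x y u.
  by rewrite /incompat_cost /pair_cost => -> /negbTE ->; rewrite /= !addn0 -addnA leq_addr.
have isym x y z : incompat_cost adj F x y z = incompat_cost adj F z y x.
  by rewrite /incompat_cost /pair_cost F_sym (adj_sym x y) (adj_sym y z) (addnC (~~ _)).
rewrite -/P -/N => hc.
have : cyclic_cost (incompat_cost adj F) s' + incompat_cost adj F (P a) a a' <=
    cyclic_cost (incompat_cost adj F) s + incompat_cost adj F (P a) a w.
  apply: hc => //.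
  - by rewrite zl.
  - by rewrite zl // 1?adj_sym // F_sym.
  - by rewrite isym (isym a) le // 1?adj_sym // F_sym.
  - by apply: le.
  - by apply: le; rewrite 1?adj_sym.
  - by apply: le.
  - by apply: le; rewrite 1?adj_sym.
(* The triple [(P a, a, w)] pays at most for a non-edge between [P a] and [a]. The triple
   [(P a, a, a')] pays for that too and for the defect as well, so the inequality is strict. *)
move: bad; rewrite /incompat_cost /pair_cost aw (negbTE f1).
move: (adj a a') (F a (P a) a') (adj (P a) a) (cyclic_cost _ s') (cyclic_cost _ s); clear.
by move=> [] [] [] c1 c2 //= _; lia.
Qed.

(** Descent on the cost: at cost 0 every step is an edge and every consecutive pair is compatible,
    and a triple of positive cost always contains a right step to which [cost_decrease] applies. *)
Theorem compatible_rearrangement s0 : (forall v x, ~~ F v x x) ->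
  uniq s0 -> size s0 = #|T| -> cycle t s0 ->
  exists s, hamilton_cycle adj s /\ compatible_cycle F s.
Proof.
move=> F_irr.
have [k] := ubnP (cyclic_cost (incompat_cost adj F) s0).
have isym x y z : incompat_cost adj F x y z = incompat_cost adj F z y x.
  by rewrite /incompat_cost /pair_cost F_sym (adj_sym x y) (adj_sym y z) (addnC (~~ _)).
elim: k s0 => // k IH s0; rewrite ltnS => s0k us sT cs.
have s2 : 2 < size s0 by rewrite sT.
have [c0|] := posnP (cyclic_cost (incompat_cost adj F) s0).
  exists s0; have := (cyclic_cost_eq0P _ us s2).1 c0 => {}c0.
  have cv v : v \in s0 -> adj v (next s0 v) /\ ~~ F v (prev s0 v) (next s0 v).
    by move/c0/eqP; rewrite !addn_eq0 !eqb0 !negbK => /andP[/andP[_ ?] ?]; split => //.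
  have cN v (vs : v \in s0) := (cv v vs).1; have cF v (vs : v \in s0) := (cv v vs).2.
  split; first by split => //; apply: cycle_from_next.
  have ce v x : cycle_edge s0 v x -> v \in s0 /\ (x = next s0 v \/ x = prev s0 v).
    case/and3P => vs xs /orP[] /eqP E; split=> //; first by left.
    by right; rewrite E prev_next.
  move=> v x y /ce[vs [] ->] /ce[_ [] ->]; rewrite ?F_irr ?cF // F_sym.
  exact: cF.
move=> cpos; suff [s' [us' sT' cs' lt]] : exists s', [/\ uniq s', size s' = #|T|, cycle t s' &
    cyclic_cost (incompat_cost adj F) s' < cyclic_cost (incompat_cost adj F) s0].
  by apply: (IH s') => //; apply: leq_trans lt _.
have [i [x [y [z [r [E cxyz]]]]]] := cyclic_cost_gt0 s2 cpos.
have u1 : uniq [:: x, y, z & r] by rewrite -E rot_uniq.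
have T1 : size [:: x, y, z & r] = #|T| by rewrite -E size_rot.
have cs1 : cycle t [:: x, y, z & r] by rewrite -E rot_cycle.
have c1 : cyclic_cost (incompat_cost adj F) [:: x, y, z & r] =
    cyclic_cost (incompat_cost adj F) s0 by rewrite -E cyclic_cost_rot.
have txy : t x y by case/andP: cs1.
have tyz : t y z by case/and3P: cs1.
have xz : x != z by move: u1; rewrite /= !inE !negb_or -!andbA => /and3P[].
have caseA : g y z -> ~~ adj y z || F y x z -> exists s', [/\ uniq s', size s' = #|T|,
    cycle t s' & cyclic_cost (incompat_cost adj F) s' < cyclic_cost (incompat_cost adj F) s0].
  move=> gyz bad; have E2 : rot 2 [:: x, y, z & r] = z :: rcons (rcons r x) y.
    by rewrite /rot /= -!cats1 -catA.
  have u2 : uniq (rot 2 [:: x, y, z & r]) by rewrite rot_uniq.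
  have := cost_decrease u2 _ E2 _ gyz; rewrite prev_rot // (@prev_cat _ [::]) //.
  by rewrite size_rot rot_cycle cyclic_cost_rot // c1; apply.
(* The defect sits at the far end of the step here, so the ordering is reversed first. *)
have caseB : g x y -> ~~ adj x y || F y x z -> exists s', [/\ uniq s', size s' = #|T|,
    cycle t s' & cyclic_cost (incompat_cost adj F) s' < cyclic_cost (incompat_cost adj F) s0].
  move=> gxy bad.
  have E2 : rev (rot 1 [:: x, y, z & r]) = x :: rcons (rcons (rev r) z) y.
    by rewrite rot1_cons rev_rcons !rev_cons.
  have u2 : uniq (rot 1 [:: x, y, z & r]) by rewrite rot_uniq.
  have u3 : uniq (rev (rot 1 [:: x, y, z & r])) by rewrite rev_uniq.
  have := cost_decrease u3 _ E2; rewrite prev_rev // next_rot // (@next_cat _ [:: x]) //.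
  rewrite size_rev size_rot (eq_cycle t_sym) rev_cycle rot_cycle.
  rewrite (cyclic_cost_rev isym) ?size_rot // cyclic_cost_rot // c1.
  by apply => //; rewrite 1?g_sym // adj_sym F_sym.
have [ayz|nayz] := boolP (adj y z); last first.
  apply: caseA; rewrite ?nayz //; case/orP: tyz => // /M_adj.
  by rewrite (negbTE nayz).
have [axy|naxy] := boolP (adj x y); last first.
  apply: caseB; rewrite ?naxy //; case/orP: txy => // /M_adj.
  by rewrite (negbTE naxy).
(* Both steps are edges, so the defect is an incompatibility at [y]. A matching cannot contain both
   edges at [y], so one of the two steps is right. *)
have fy : F y x z by move: cxyz; rewrite /incompat_cost /pair_cost axy ayz lt0b.
case/orP: tyz => [gyz|Myz]; first by apply: caseA; rewrite // fy orbT.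
case/orP: txy => [gxy|Mxy]; first by apply: caseB; rewrite // fy orbT.
by rewrite (M_matching Myz (_ : M y x)) ?eqxx // M_sym in xz.
Qed.
End Core.

(** * Dirac's theorem *)

(** The 2-opt move: reversing [S2] replaces the steps [p q] and [a a'] by [p a] and [q a']. *)
Lemma cyclic_cost_2opt (T : eqType) (c : T -> T -> T -> nat) S1 S2
    a' b1 l1 l1' u p q q1 l2 l2' a1 a :
  (forall x y z, c x y z = c z y x) ->
  S1 = [:: a', b1 & l1'] -> S1 = l1 ++ [:: u; p] ->
  S2 = [:: q, q1 & l2] -> S2 = l2' ++ [:: a1; a] ->
  let k := triple_cost c S1 + triple_cost c S2 in
  cyclic_cost c (S1 ++ S2) = k + c u p q + c p q q1 + c a1 a a' + c a a' b1 /\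
  cyclic_cost c (S1 ++ rev S2) = k + c u p a + c p a a1 + c q1 q a' + c q a' b1.
Proof.
move=> c_sym E1 E1' E2 E2' k; rewrite {}/k.
have tk R : take 2 (S1 ++ R) = [:: a'; b1] by rewrite E1 /= take0.
have E3 : rev S2 = [:: a, a1 & rev l2'] by rewrite E2' rev_cat.
have E3' : rev S2 = rev l2 ++ [:: q1; q] by rewrite E2 !rev_cons -!cats1 -catA.
rewrite /cyclic_cost !tk; split.
  have -> : (S1 ++ S2) ++ [:: a'; b1] = l1 ++ [:: u, p, q, q1 & l2 ++ [:: a'; b1]].
    by rewrite E1' E2 /= -!catA.
  have -> := triple_cost_join c l1 u p q q1; rewrite -E1'.
  have -> : [:: q, q1 & l2 ++ [:: a'; b1]] = l2' ++ [:: a1, a, a', b1 & [::]].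
    by rewrite -[LHS]/([:: q, q1 & l2] ++ _) -E2 E2' -catA.
  by rewrite triple_cost_join -E2' /=; lia.
have -> : (S1 ++ rev S2) ++ [:: a'; b1] = l1 ++ [:: u, p, a, a1 & rev l2' ++ [:: a'; b1]].
  by rewrite E1' E3 /= -!catA.
have -> := triple_cost_join c l1 u p a a1; rewrite -E1'.
have -> : [:: a, a1 & rev l2' ++ [:: a'; b1]] = rev l2 ++ [:: q1, q, a', b1 & [::]].
  by rewrite -[LHS]/([:: a, a1 & rev l2'] ++ _) -E3 E3' -catA.
by rewrite triple_cost_join -E3' triple_cost_rev //=; lia.
Qed.

Lemma seq_ends2 (T : Type) (S : seq T) : 1 < size S ->
  exists x y r r' x' y', S = [:: x, y & r] /\ S = r' ++ [:: x'; y'].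
Proof.
case/lastP: S => [|S y] //; case/lastP: S => [|S x] // _.
case: S => [|z [|w S]]; rewrite -!cats1.
- by exists x, y, [::], [::], x, y.
- by exists z, x, [:: y], [:: z], x, y.
by exists z, w, (S ++ [:: x; y]), [:: z, w & S], x, y; split; rewrite /= -?catA.
Qed.

(** Descent on the number of non-edges in a cyclic ordering: a 2-opt move removes a non-edge [a a']
    at the price of one other step, using two edges. *)
Theorem dirac (T : finType) (adj : rel T) :
  symmetric adj -> irreflexive adj -> 2 < #|T| ->
  (forall v, #|T| <= 2 * deg adj v) -> exists s, hamilton_cycle adj s.
Proof.
move=> adj_sym adj_irr T3 dg; pose c := pair_cost adj.
have c_sym x y z : c x y z = c z y x by rewrite /c /pair_cost addnC (adj_sym z y) (adj_sym y x).
suff [s [us sT cs]] : exists s, [/\ uniq s, size s = #|T| & cyclic_cost c s = 0].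
  have s2 : 2 < size s by rewrite sT.
  by exists s; split => //; apply/cyclic_cost_pair.
have [k] := ubnP (cyclic_cost c (enum T)).
have : size (enum T) = #|T| by rewrite cardE.
elim: k (enum T) (enum_uniq T) => // k IH s us sT; rewrite ltnS => sk.
have s2 : 2 < size s by rewrite sT.
have [c0|cpos] := posnP (cyclic_cost c s); first by exists s.
have [r [m [a [a' [ur rT cr E naa']]]]] : exists r m a a', [/\ uniq r, size r = #|T|,
    cyclic_cost c r = cyclic_cost c s, r = a' :: rcons m a & ~~ adj a a'].
  have [i [x [y [z [r [E cxyz]]]]]] := cyclic_cost_gt0 s2 cpos.
  have [naxy|] := boolP (~~ adj x y).
    exists (rot 1 (rot i s)), (z :: r), x, y; split=> //; rewrite ?rot_uniq ?size_rot //.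
      by rewrite !cyclic_cost_rot ?size_rot.
    by rewrite E rot1_cons.
  rewrite negbK => axy; exists (rot 2 (rot i s)), (rcons r x), y, z.
  split=> //; rewrite ?rot_uniq ?size_rot //.
  - by rewrite !cyclic_cost_rot ?size_rot.
  - by rewrite E /rot /= -!cats1 -catA.
  - by move: cxyz; rewrite /c /pair_cost axy; case: (adj y z).
have ra x : x \in r.
  suff -> : r =i predT by [].
  by apply/subset_cardP; [rewrite (card_uniqP ur) rT | apply/subsetP].
have nexta : next r a = a'.
  rewrite -(next_rotr 1 ur); have Er : rotr 1 r = [:: a, a' & m].
    by rewrite E -rcons_cons rotr1_rcons.
  by move: (ur); rewrite -(rotr_uniq 1) Er => ?; apply: (@next_cat _ [::]).
(* The neighbours of [a] and the predecessors of neighbours of [a'] number at least [#|T|] together,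
   but neither set contains [a], so they meet. *)
have [p ap a'p] : exists2 p, adj a p & adj a' (next r p).
  pose X := [set p | adj a p]; pose Y := next r @^-1: [set p | adj a' p].
  have cY : #|Y| = deg adj a' by rewrite card_preimset //; apply: can_inj (prev_next ur).
  have : #|X :|: Y| < #|T|.
    rewrite -cardsT proper_card // properE subsetT; apply/subsetPn; exists a => //.
    by rewrite !inE adj_irr nexta adj_irr.
  have := cardsUI X Y; have := dg a; have := dg a'; rewrite {2}/deg -/X -cY => h1 h2 h3 h4.
  have /card_gt0P[p] : 0 < #|X :&: Y| by lia.
  by rewrite !inE => /andP[]; exists p.
have [[l1 l2] /= rE] : exists l : seq T * seq T, r = l.1 ++ p :: l.2.
  by have := ra p; case/splitPr => l1 l2; exists (l1, l2).
(* [p] is neither the first entry nor one of the last two, since [a a'] is not an edge and there are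
   no loops. Hence both segments have the two entries that the move requires. *)
case: l1 rE => [|u l1] rE.
  by move: naa'; rewrite E in rE; case: rE ap => -> _ ->.
case: l2 rE => [|q l2] rE.
  have := congr1 (last a') rE; rewrite E /= last_rcons last_cat /= => ea.
  by move: ap; rewrite -ea adj_irr.
have nq : next r p = q by move: (ur); rewrite rE; apply: next_cat.
case: l2 rE => [|q1 l2] rE.
  have := congr1 (last a') rE; rewrite E /= last_rcons last_cat /= => ea.
  by move: a'p; rewrite nq -ea adj_sym (negbTE naa').
have [|b0 [b1 [l1' [k1 [v [p' [E1 E1']]]]]]] := @seq_ends2 T (rcons (u :: l1) p).
  by rewrite size_rcons.
have [|d0 [d1 [k2 [k2' [a1 [a2 [E2 E2']]]]]]] := @seq_ends2 T [:: q, q1 & l2]; first by [].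
have rE' : r = rcons (u :: l1) p ++ [:: q, q1 & l2] by rewrite cat_rcons rE.
have b0E : b0 = a' by have := congr1 (head p) rE'; rewrite E1 E.
have p'E : p' = p by have := congr1 (last p) E1'; rewrite last_rcons last_cat.
have a2E : a2 = a by have := congr1 (last p) rE'; rewrite E2' E /= last_rcons !last_cat.
case: (E2) => d0E d1E _; subst b0 p' a2 d0 d1.
have := cyclic_cost_2opt c_sym E1 E1' E2 E2'; rewrite -rE' => -[c1 c2].
apply: (IH (rcons (u :: l1) p ++ rev [:: q, q1 & l2])).
- by rewrite cat_uniq rev_uniq has_rev -cat_uniq -rE'.
- by rewrite size_cat size_rev -size_cat -rE'.
- apply: leq_trans sk; rewrite -cr c1 c2 /c /pair_cost.
  rewrite nq in a'p; rewrite (adj_sym p a) ap (adj_sym q a') a'p (negbTE naa').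
  rewrite (adj_sym a a1) (adj_sym q1 q).
  move: (triple_cost _ _) (triple_cost _ _) (adj u p) (adj p q) (adj q q1) (adj a1 a) (adj a' b1).
  by clear; move=> k1 k2 [] [] [] [] []; lia.
Qed.

(** * Adjusting the partition *)

Definition gdeg (T : finType) (adj : rel T) (side : T -> bool) b (v : T) : nat :=
  #|[set u | adj v u && good side b v u]|.

(** Ordered pairs: a missing edge counts twice, and for [b = false] each diagonal pair without a
    loop counts as well. *)
Definition nonadj (T : finType) (adj : rel T) (side : T -> bool) b : nat :=
  #|[set e : T * T | good side b e.1 e.2 && ~~ adj e.1 e.2]|.

Lemma leq_card_setU (T : finType) (A B C : {set T}) :
  A \subset B :|: C -> #|A| <= #|B| + #|C|.
Proof. by move/subset_leq_card/leq_trans; apply; rewrite cardsU leq_subr. Qed.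

Section Switch.
Variables (T : finType) (adj : rel T) (side : T -> bool) (b : bool) (W : {set T}).
Let side' v := side v (+) (v \in W).

Lemma nonadj_switch : nonadj adj side' b <= nonadj adj side b + 2 * (#|T| * #|W|).
Proof.
have h1 := @card_pairs_row T (fun _ y => y \in W) #|W| (fun _ => eq_leq (cardsE _)).
have h2 := @card_pairs_col T (fun x _ => x \in W) #|W| (fun _ => eq_leq (cardsE _)).
rewrite mul2n -addnn addnA.
apply: leq_trans (leq_add (leq_add (leqnn _) h2) h1).
apply: leq_trans (leq_card_setU _) _; last first.
  apply: leq_add (leqnn _); apply: leq_card_setU; exact: subxx.
apply/subsetP => -[x y]; rewrite !inE /good /side' /=.
by case: (x \in W); case: (y \in W); rewrite ?addbF ?orbT // => ->.
Qed.

Lemma gdeg_switch v : gdeg adj side b v <= gdeg adj side' b v + #|W| + (v \in W) * #|T|.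
Proof.
have [vW|vW] := boolP (v \in W).
  by rewrite mul1n; apply: leq_trans (max_card _) (leq_addl _ _).
rewrite addn0; apply: leq_card_setU; apply/subsetP => u; rewrite !inE /good /side'.
by rewrite (negbTE vW); case: (u \in W); rewrite ?orbT ?addbF // => ->.
Qed.

(** A neighbour outside [W] of a moved vertex is of the right kind for exactly one of the two
    partitions. *)
Lemma deg_switch v : v \in W -> deg adj v <= gdeg adj side b v + gdeg adj side' b v + #|W|.
Proof.
move=> vW; rewrite -addnA; apply: leq_trans (leq_add (leqnn _) (leq_card_setU (subxx _))).
apply: leq_card_setU; apply/subsetP => u; rewrite !inE /good /side' vW.
by case: (adj v u) => //=; case: (side v) (side u) (u \in W) b => [] [] [] [].
Qed.
End Switch.

(** Vertices with fewer than [#|T| / 8] right neighbours change side. Each has at least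
    [(499 - 125) / 1000 = 374 / 1000] of all vertices as right non-neighbours, so they are few;
    after the move their degree of about half serves them, while the others lose at most [#|W|]. *)
Lemma reassign (T : finType) (adj : rel T) (side : T -> bool) (b : bool) :
  (forall v, #|T| <= 2 * deg adj v) ->
  (forall v, 499 * #|T| <= 1000 * #|[set u | good side b v u]|) ->
  exists W : {set T}, let side' v := side v (+) (v \in W) in
    [/\ 374 * (#|W| * #|T|) <= 1000 * nonadj adj side b,
        forall v, #|T| <= 8 * (gdeg adj side' b v + #|W|) &
        nonadj adj side' b <= nonadj adj side b + 2 * (#|T| * #|W|)].
Proof.
move=> dg sz; pose W := [set v | 8 * gdeg adj side b v < #|T|].
exists W => side'; split; last exact: nonadj_switch.
  rewrite /nonadj (card_pairsE (fun x y => good side b x y && ~~ adj x y)).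
  rewrite big_distrr /= -sum_nat_const big_distrr /=.
  rewrite [X in _ <= X](bigID (mem W)) /=; apply: leq_trans (leq_addr _ _).
  apply: leq_sum => v; rewrite inE => vW.
  have := sz v; rewrite -(cardsID [set u | adj v u] [set u | good side b v u]).
  have -> : [set u | good side b v u] :&: [set u | adj v u] =
    [set u | adj v u && good side b v u] by apply/setP => u; rewrite !inE andbC.
  have -> : [set u | good side b v u] :\: [set u | adj v u] =
    [set u | good side b v u && ~~ adj v u] by apply/setP => u; rewrite !inE andbC.
  rewrite -/(gdeg adj side b v) in vW *.
  set X := #|[set u | good side b v u && ~~ adj v u]| => h.
  have : 374 * #|T| <= 1000 * X by clear -vW h; lia.
  exact.
move=> v; have [vW|vW] := boolP (v \in W).
  have := deg_switch adj side b vW; have := dg v.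
  by move: (vW); rewrite inE -/side'; lia.
have := gdeg_switch adj side b W v; rewrite (negbTE vW) addn0 -/side'.
by move: vW; rewrite inE -leqNgt; lia.
Qed.

(** * Initial orderings *)

Section PairList.
Variable (T : eqType).

Definition flat (ms : seq (T * T)) : seq T := flatten [seq [:: e.1; e.2] | e <- ms].

Definition matched (ms : seq (T * T)) : rel T :=
  fun x y => ((x, y) \in ms) || ((y, x) \in ms).

Lemma size_flat ms : size (flat ms) = 2 * size ms.
Proof. by rewrite /flat; elim: ms => //= e ms ->; rewrite mulnS. Qed.

Lemma mem_flat ms e : e \in ms -> (e.1 \in flat ms) && (e.2 \in flat ms).
Proof.
by move=> ems; apply/andP; split; apply/flattenP; exists [:: e.1; e.2];
  rewrite ?inE ?eqxx ?orbT //; apply/mapP; exists e.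
Qed.

Lemma matched_flat ms x y : matched ms x y -> x \in flat ms.
Proof. by case/orP => /mem_flat /andP[]. Qed.

Lemma matched_sym ms : symmetric (matched ms).
Proof. by move=> x y; rewrite /matched orbC. Qed.

Lemma matched_inj ms x y z : uniq (flat ms) -> matched ms x y -> matched ms x z -> y = z.
Proof.
elim: ms => [|[p q] ms IH] //=; rewrite inE negb_or => /and3P[/andP[pq pm] qm us].
have hm u v : matched ms u v -> [/\ u != p, u != q, v != p & v != q].
  move=> uv; have um := matched_flat uv; rewrite matched_sym in uv; have vm := matched_flat uv.
  by split; apply/eqP => E; move: um vm pm qm; rewrite -/(flat ms) E => h1 h2 h3 h4;
    rewrite ?h1 ?h2 // in h3 h4.
have hc u v : matched ((p, q) :: ms) u v ->
    [\/ (u, v) = (p, q), (u, v) = (q, p) | matched ms u v].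
  rewrite /matched !inE; case/orP => /orP[/eqP[-> ->]|h]; rewrite ?h ?orbT;
  by [constructor 1 | constructor 2 | constructor 3].
move=> /hc[[xp yq]|[xq yp]|xy] /hc[[xp' zq]|[xq' zp]|xz].
- by rewrite yq zq.
- by move: pq; rewrite -xp -xq' eqxx.
- by have [] := hm _ _ xz; rewrite xp eqxx.
- by move: pq; rewrite -xp' -xq eqxx.
- by rewrite yp zp.
- by have [_] := hm _ _ xz; rewrite xq eqxx.
- by have [] := hm _ _ xy; rewrite xp' eqxx.
- by have [_] := hm _ _ xy; rewrite xq' eqxx.
exact: IH us xy xz.
Qed.

(** The blocks will be single vertices or matching edges of the larger class, separated by vertices
    of the smaller one. *)
Fixpoint weave (bs : seq (seq T)) (ys : seq T) : seq T :=
  if (bs, ys) is (b :: bs', y :: ys') then b ++ y :: weave bs' ys' else [::].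

Lemma weave_perm bs ys : size bs = size ys ->
  perm_eq (weave bs ys) (flatten bs ++ ys).
Proof.
elim: bs ys => [|b bs IH] [|y ys] //= [/IH/permP wP].
apply/permP => f; rewrite !count_cat /= wP !count_cat /=; lia.
Qed.

Lemma weave_path (t : rel T) (X Y : pred T) bs ys y0 : size bs = size ys ->
  (forall x y, X x -> Y y -> t x y /\ t y x) ->
  (forall b, b \in bs -> exists x m, [/\ b = x :: m, path t x m & all X b]) ->
  all Y ys -> Y y0 ->
  path t y0 (weave bs ys) /\ Y (last y0 (weave bs ys)).
Proof.
move=> + tXY; elim: bs ys y0 => [|b bs IH] [|y ys] y0 //= [sz] hb /andP[Yy Yys] Yy0.
have [x [m [-> px /= /andP[Xx Xm]]]] := hb b (mem_head _ _).
have [||| p1 p2] := IH _ y sz => //; first by move=> c cb; apply: hb; rewrite inE cb orbT.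
have Xl : X (last x m).
  by elim: m x Xx Xm {px} => //= z m IHm x _ /andP[Xz]; apply: IHm.
rewrite cat_path last_cat /= px p1 (tXY _ _ Xx Yy0).2 (tXY _ _ Xl Yy).1; split => //.
Qed.
End PairList.

Lemma card_mem_le (T : finType) (s : seq T) : #|[set x in s]| <= size s.
Proof.
apply: leq_trans (card_size s); apply: subset_leq_card.
by apply/subsetP => x; rewrite inE.
Qed.

(** The surplus [2 * size ms] in the degree pays for discarding neighbours that are endpoints of the
    matching. *)
Lemma compatible_from_matching (T : finType) (adj : rel T) (F : T -> rel T)
    (side : T -> bool) b (ms : seq (T * T)) (N0 D L : nat) (s0 : seq T) :
  symmetric adj -> incompat_system adj F ->
  (forall v x, #|[set y | F v x y]| <= D) ->
  uniq (flat ms) -> {in ms, forall e, adj e.1 e.2} ->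
  nonadj adj side b <= N0 -> (forall v, L + 2 * size ms <= gdeg adj side b v) ->
  2 < #|T| -> 3 * N0 + 8 * (#|T| * D) + 25 * #|T| < L * L ->
  uniq s0 -> size s0 = #|T| -> cycle (fun x y => good side b x y || matched ms x y) s0 ->
  exists s, hamilton_cycle adj s /\ compatible_cycle F s.
Proof.
move=> adj_sym Fsys Fb ums mse nN dL T2 Llarge us sT cs.
apply: (@compatible_rearrangement T adj (matched ms) F side b L N0 D) cs => //.
- by move=> v x y; apply/idP/idP => /Fsys[].
- exact: matched_sym.
- by move=> x y /orP[] /mse //; rewrite adj_sym.
- by move=> x y z; apply: matched_inj.
- move=> v; rewrite -(leq_add2r (2 * size ms)); apply: leq_trans (dL v) _.
  rewrite -size_flat; apply: leq_trans (leq_add (leqnn _) (card_mem_le (flat ms))).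
  apply: leq_card_setU; apply/subsetP => u; rewrite !inE => /andP[-> ->] /=.
  have [um|um] := boolP (u \in flat ms); first by rewrite orbT.
  by rewrite orbF; apply/forallP => z; apply/negP => /matched_flat; apply/negP.
by move=> v x; apply/negP => /Fsys[_ _]; rewrite eqxx.
Qed.

Lemma uniq_perm_full (T : finType) (s : seq T) :
  (forall x, x \in s) -> size s = #|T| -> uniq s.
Proof.
move=> sx sz; apply: (leq_size_uniq (enum_uniq T)) => [x _ //|].
by rewrite sz cardE.
Qed.

(** Gluing each matching edge into one block leaves as many blocks in the larger class as there are
    vertices in the smaller one, so the two can alternate around the cycle. *)
Lemma bipartite_arrangement (T : finType) (side : T -> bool) (ms : seq (T * T)) :
  uniq (flat ms) -> {in flat ms, forall x, side x} -> 0 < #|T| ->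
  #|[set v | side v]| = #|[set v | ~~ side v]| + size ms ->
  exists s0, [/\ uniq s0, size s0 = #|T| &
    cycle (fun x y => good side true x y || matched ms x y) s0].
Proof.
move=> ums mX T0 cXY.
pose X := [set v | side v]; pose X' := X :\: [set x in flat ms].
pose Y := [set v | ~~ side v].
pose bs := [seq [:: e.1; e.2] | e <- ms] ++ [seq [:: x] | x <- enum X'].
have cm : #|[set x in flat ms]| = 2 * size ms.
  by rewrite -size_flat -(card_uniqP ums); apply: eq_card => x; rewrite inE.
have mXs : [set x in flat ms] \subset X.
  by apply/subsetP => x; rewrite !inE; apply: mX.
have cX' : #|X'| + 2 * size ms = #|X|.
  by rewrite -cm /X' cardsD (setIidPr mXs) subnK // subset_leq_card.
have sbs : size bs = size (enum Y).
  by rewrite size_cat !size_map -!cardE; move: cXY cX'; rewrite -/X -/Y; lia.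
have fx : flatten bs = flat ms ++ enum X'.
  by rewrite flatten_cat -/(flat ms); congr (_ ++ _); elim: (enum X') => //= x l ->.
have cT : #|X| + #|Y| = #|T|.
  rewrite -(cardsC X) /X /Y; congr (_ + _); apply: eq_card => x; by rewrite !inE.
have wp := weave_perm sbs; exists (weave bs (enum Y)).
have sz : size (weave bs (enum Y)) = #|T|.
  by rewrite (perm_size wp) fx !size_cat size_flat -!cardE -cT -cX' (addnC #|X'|).
have us : uniq (weave bs (enum Y)).
  apply: uniq_perm_full => // x; rewrite (perm_mem wp) fx !mem_cat !mem_enum !inE.
  by case: (x \in flat ms) => //=; case: (side x).
split => //.
have [y0 y0Y] : exists y, y \in Y.
  apply/card_gt0P; move: cT cX' cXY; rewrite -/X -/Y; lia.
set t := (X in cycle X _).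
have tg x y : good side true x y -> t x y by rewrite /t => ->.
have P z : z \in Y -> path t z (weave bs (enum Y)) /\ last z (weave bs (enum Y)) \in Y.
  move=> zY; apply: (@weave_path T t (mem X) (mem Y)) => //.
  - by move=> x y; rewrite !inE => sx sy; split; apply: tg; rewrite /good sx (negbTE sy).
  - move=> b; rewrite mem_cat => /orP[] /mapP[e em ->].
      exists e.1, [:: e.2]; split => //=; last first.
        by have /andP[e1 e2] := mem_flat em; rewrite !inE !mX.
      by rewrite /t /matched -surjective_pairing em orbT.
    by exists e, [::]; split => //=; move: em; rewrite mem_enum !inE => /andP[_ ->].
  - by apply/allP => y; rewrite mem_enum.
by rewrite (cycle_path y0); apply: (P _ (P _ y0Y).2).1.
Qed.

Lemma same_side_path (T : eqType) (t : rel T) (x : T) (l : seq T) :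
  (forall y z, y \in x :: l -> z \in x :: l -> t y z) -> path t x l.
Proof.
elim: l x => //= y l IH x h; rewrite h ?inE ?eqxx ?orbT //=; apply: IH => u v ul vl.
by apply: h; rewrite inE ?ul ?vl orbT.
Qed.

(** Traverse one side from [y1] to [x1], cross to [x2], traverse the other side to [y2], and cross
    back. *)
Lemma two_cliques_arrangement (T : finType) (side : T -> bool) x1 x2 y1 y2 :
  side x1 -> side y1 -> ~~ side x2 -> ~~ side y2 -> x1 != y1 -> x2 != y2 ->
  exists s0, [/\ uniq s0, size s0 = #|T| & cycle
    (fun x y => good side false x y || matched [:: (x1, x2); (y1, y2)] x y) s0].
Proof.
move=> sx1 sy1 sx2 sy2 xy1 xy2; set t := (X in cycle X).
pose A := [set v | side v] :\: [set x1; y1].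
pose B := [set v | ~~ side v] :\: [set x2; y2].
exists (y1 :: rcons (enum A) x1 ++ x2 :: rcons (enum B) y2).
have sz : size (y1 :: rcons (enum A) x1 ++ x2 :: rcons (enum B) y2) = #|T|.
  rewrite /= size_cat /= !size_rcons -!cardE /A /B !cardsD.
  have -> : [set v | side v] :&: [set x1; y1] = [set x1; y1].
    by apply/setIidPr/subsetP => x; rewrite !inE => /orP[] /eqP ->.
  have -> : [set v | ~~ side v] :&: [set x2; y2] = [set x2; y2].
    by apply/setIidPr/subsetP => x; rewrite !inE => /orP[] /eqP ->.
  have h1 : #|[set x1; y1]| <= #|[set v | side v]|.
    by apply: subset_leq_card; apply/subsetP => x; rewrite !inE => /orP[] /eqP ->.
  have h2 : #|[set x2; y2]| <= #|[set v | ~~ side v]|.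
    by apply: subset_leq_card; apply/subsetP => x; rewrite !inE => /orP[] /eqP ->.
  rewrite !cards2 xy1 xy2 in h1 h2 *.
  have := cardsC [set v | side v].
  have -> : ~: [set v | side v] = [set v | ~~ side v] by apply/setP => x; rewrite !inE.
  by move: h1 h2; clear; rewrite /=; lia.
have tg x y : side x = side y -> t x y by rewrite /t /good => ->; rewrite addbb.
have sA x : x \in y1 :: rcons (enum A) x1 -> side x.
  by rewrite inE mem_rcons inE mem_enum !inE => /or3P[/eqP->|/eqP->|/andP[]].
have sB x : x \in x2 :: rcons (enum B) y2 -> side x = false.
  by rewrite inE mem_rcons inE mem_enum !inE => /or3P[/eqP->|/eqP->|/andP[_]]; apply: negbTE.
split => //.
  apply: uniq_perm_full => // x.
  rewrite -cat_cons mem_cat !inE !mem_rcons !inE !mem_enum !inE.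
  by case: (x == x1) (x == x2) (x == y1) (x == y2) (side x) => [] [] [] [] [].
rewrite /= rcons_cat cat_path last_rcons /=; apply/and3P; split.
- by apply: same_side_path => x y /sA hx /sA hy; apply: tg; rewrite hx hy.
- by rewrite /t /matched !inE eqxx ?orbT.
rewrite rcons_path last_rcons; apply/andP; split.
  by apply: same_side_path => x y /sB hx /sB hy; apply: tg; rewrite hx hy.
by rewrite /t /matched !inE eqxx ?orbT.
Qed.

(** * Balancing *)

Definition nbrs_in (T : finType) (adj : rel T) (B : {set T}) (x : T) : nat :=
  #|[set y in B | adj x y]|.

Lemma nbrs_inE (T : finType) (adj : rel T) (B : {set T}) x :
  nbrs_in adj B x = \sum_(y in B) adj x y.
Proof.
by rewrite /nbrs_in -sum1dep_card big_mkcondr.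
Qed.

Lemma e_betweenE (T : finType) (adj : rel T) (A B : {set T}) :
  e_between adj A B = \sum_(x in A) nbrs_in adj B x.
Proof. by apply: eq_bigr => x _; rewrite nbrs_inE. Qed.

Lemma e_between_sym (T : finType) (adj : rel T) (A B : {set T}) :
  symmetric adj -> e_between adj A B = e_between adj B A.
Proof.
move=> adj_sym; rewrite /e_between exchange_big /=.
by apply: eq_bigr => x _; apply: eq_bigr => y _; rewrite adj_sym.
Qed.

Lemma nbrs_in_le (T : finType) (adj : rel T) (B : {set T}) x : nbrs_in adj B x <= #|B|.
Proof. by apply: subset_leq_card; apply/subsetP => y; rewrite !inE => /andP[]. Qed.

Lemma nbrs_inS (T : finType) (adj : rel T) (A B : {set T}) x :
  A \subset B -> nbrs_in adj A x <= nbrs_in adj B x.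
Proof.
move=> /subsetP AB; apply: subset_leq_card; apply/subsetP => y; rewrite !inE.
by move=> /andP[/AB -> ->].
Qed.

Lemma deg_nbrs_in (T : finType) (adj : rel T) (A B : {set T}) x :
  (forall y, (y \in A) || (y \in B)) -> deg adj x <= nbrs_in adj A x + nbrs_in adj B x.
Proof.
move=> AB; apply: leq_card_setU; apply/subsetP => y; rewrite !inE => ->.
by rewrite !andbT.
Qed.

Lemma card_sides (T : finType) (side : T -> bool) :
  #|[set v | side v]| + #|[set v | ~~ side v]| = #|T|.
Proof.
by rewrite -(cardsC [set v | side v]); congr (_ + _); apply: eq_card => x; rewrite !inE.
Qed.

(* If a matching of size j < k inside X cannot be extended, the k/2 neighbours
   that every vertex has inside X all lie on its 2j endpoints, one of which
   therefore has about |X|/4 neighbours inside X. *)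
Lemma matching_or_degree (T : finType) (adj : rel T) (side : T -> bool) k j :
  let X := [set v | side v] in
  symmetric adj -> irreflexive adj -> (forall v, #|T| <= 2 * deg adj v) ->
  #|X| = #|[set v | ~~ side v]| + k -> j <= k ->
  (exists ms, [/\ size ms = j, uniq (flat ms), {in flat ms, forall x, side x} &
      {in ms, forall e, adj e.1 e.2}])
  \/ (exists v, [/\ side v, #|X| <= 4 * nbrs_in adj X v + 2 * k & 2 <= k]).
Proof.
move=> X adj_sym adj_irr dg cX; elim: j => [|j IH] jk; first by left; exists [::].
have [[ms [sms ums mX mse]]|] := IH (ltnW jk); last by right.
pose V := [set x in flat ms].
have cV : #|V| = 2 * j.
  by rewrite -sms -size_flat -(card_uniqP ums); apply: eq_card => x; rewrite inE.
have VX : V \subset X by apply/subsetP => x; rewrite !inE; apply: mX.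
have [/existsP[x /existsP[y /and3P[xX yX xy]]]|noext] :=
  boolP [exists x, exists y, [&& x \in X :\: V, y \in X :\: V & adj x y]].
  left; exists ((x, y) :: ms); move: xX yX xy; rewrite !inE => /andP[xV xX] /andP[yV yX] xy.
  have xny : x != y by apply/eqP => E; rewrite E adj_irr in xy.
  split => /=; rewrite ?sms //.
  - by rewrite inE negb_or -/(flat ms) xny xV yV ums.
  - by move=> z; rewrite -/(flat ms) !inE => /or3P[/eqP->|/eqP->|/mX].
  - by move=> z; rewrite inE => /predU1P[->|/mse].
have [/existsP[v /andP[vV hv]]|nov] :=
    boolP [exists v, (v \in V) && (#|X| <= 4 * nbrs_in adj X v + 2 * k)].
  right; exists v; split => //; first by have /subsetP/(_ _ vV) := VX; rewrite inE.
  have : 0 < #|V| by apply/card_gt0P; exists v.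
  by rewrite cV; lia.
exfalso; pose S := e_between adj (X :\: V) V.
have cXV : #|X :\: V| + 2 * j = #|X|.
  by rewrite -cV cardsD (setIidPr VX) subnK // subset_leq_card.
have lo : k * #|X :\: V| <= 2 * S.
  rewrite /S e_betweenE big_distrr /= mulnC -sum_nat_const; apply: leq_sum => x xXV.
  have h : nbrs_in adj X x <= nbrs_in adj V x.
    apply: subset_leq_card; apply/subsetP => y.
    rewrite in_set [in X in _ -> X]in_set => /andP[yX xy]; rewrite xy andbT.
    apply: contraR noext => yV; apply/existsP; exists x; apply/existsP; exists y.
    by rewrite xXV in_setD yV yX xy.
  have := dg x; have := card_sides side; rewrite -/X.
  have := @deg_nbrs_in T adj X [set v | ~~ side v] x.
  have := nbrs_in_le adj [set v | ~~ side v] x.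
  have all y : (y \in X) || (y \in [set v | ~~ side v]) by rewrite !inE orbN.
  move=> h1 /(_ all) h2 h3 h4; clear -h h1 h2 h3 h4 cX; lia.
(* The summand [2 * k] in the degree alternative makes the terms [4 * j * k] of the two estimates
   cancel, leaving [k * #|X| < j * #|X|], which contradicts [j < k]. *)
have hi : 4 * S + 2 * j * (2 * k + 1) <= 2 * j * #|X|.
  rewrite /S e_between_sym // e_betweenE big_distrr /= -cV -!sum_nat_const -big_split /=.
  apply: leq_sum => v vV; have /existsPn/(_ v) := nov; rewrite vV /= -ltnNge.
  have := nbrs_inS adj v (subsetDl X V); lia.
have X0 : 0 < #|X| by rewrite cX; lia.
clear -cXV lo hi X0 jk; nia.
Qed.

(** Either the [k] surplus vertices are absorbed by a matching of size [k], or a vertex of [X] with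
    many neighbours in [X] moves across. The move lowers the surplus by 2 and any other right degree
    by at most 1, so induction applies with [k - 2] and [L - 1]. *)
Lemma balance (T : finType) (adj : rel T) : symmetric adj -> irreflexive adj ->
  (forall v, #|T| <= 2 * deg adj v) -> forall k side L,
  #|[set v | side v]| = #|[set v | ~~ side v]| + k ->
  4 * L + 2 * k <= #|[set v | side v]| -> (forall v, L <= gdeg adj side true v) ->
  exists (side' : T -> bool) (ms : seq (T * T)),
  [/\ size ms <= k, uniq (flat ms), {in ms, forall e, adj e.1 e.2} &
     {in flat ms, forall x, side' x}] /\
  [/\ #|[set v | side' v]| = #|[set v | ~~ side' v]| + size ms,
     forall v, L <= gdeg adj side' true v + k &
     nonadj adj side' true <= nonadj adj side true + #|T| * k].
Proof.
move=> adj_sym adj_irr dg k; have [N] := ubnP k.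
elim: N k => // N IH k; rewrite ltnS => kN side L cX cL dL.
have [[ms [sms ums mX mse]]|[v [sv hv k2]]] :=
    matching_or_degree adj_sym adj_irr dg cX (leqnn k).
  exists side, ms; rewrite sms; split; split => //; last exact: leq_addr.
  by move=> v; apply: leq_trans (dL v) (leq_addr _ _).
pose side1 u := side u (+) (u \in [set v]).
have X1 : [set u | side1 u] = [set u | side u] :\ v.
  apply/setP => u; rewrite !inE /side1 inE; have [->|] := eqVneq u v; first by rewrite sv.
  by rewrite addbF.
have Y1 : [set u | ~~ side1 u] = v |: [set u | ~~ side u].
  apply/setP => u; rewrite !inE /side1 inE; have [->|] := eqVneq u v; first by rewrite sv.
  by rewrite addbF.
have cX1 : #|[set u | side1 u]|.+1 = #|[set u | side u]|.
  by rewrite X1 [RHS](cardsD1 v) inE sv.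
have cY1 : #|[set u | ~~ side1 u]| = #|[set u | ~~ side u]|.+1.
  by rewrite Y1 cardsU1 inE sv.
have [|||u|side' [ms [h1 [h2 h3 h4]]]] := IH (k - 2) _ side1 (L - 1).
- by clear -k2 kN; lia.
- by clear -cX1 cY1 cX k2; lia.
- by clear -cX1 cL k2; lia.
- have [->|uv] := eqVneq u v.
    suff : nbrs_in adj [set u | side u] v <= gdeg adj side1 true v by clear -hv cL; lia.
    apply: subset_leq_card; apply/subsetP => z; rewrite !inE => /andP[sz vz].
    rewrite vz /good /side1 !inE eqxx sv.
    by have [E|] := eqVneq z v; [rewrite E adj_irr in vz | rewrite sz].
  have := gdeg_switch adj side true [set v] u; rewrite inE (negbTE uv) cards1 mul0n addn0 -/side1.
  by have := dL u; clear; lia.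
exists side', ms; case: h1 => h11 h12 h13 h14; split; split => //.
- by clear -h11; lia.
- by move=> u; have := h3 u; clear -k2; lia.
have := nonadj_switch adj side true [set v]; rewrite cards1 muln1 -/side1.
move: h4 k2; clear; nia.
Qed.

(** By the degree condition every vertex of the smaller class has a neighbour across. Only two such
    vertices with the same neighbour across cause trouble. *)
Lemma disjoint_crossing_edges (T : finType) (adj : rel T) (side : T -> bool) :
  symmetric adj -> irreflexive adj -> (forall v, #|T| <= 2 * deg adj v) ->
  1 < #|[set v | side v]| -> 1 < #|[set v | ~~ side v]| ->
  exists x1 x2 y1 y2, [/\ side x1, side y1, ~~ side x2 & ~~ side y2] /\
    [/\ x1 != y1, x2 != y2, adj x1 x2 & adj y1 y2].
Proof.
move=> adj_sym adj_irr dg.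
wlog XY : side / #|[set v | side v]| <= #|[set v | ~~ side v]|.
  move=> W X1 Y1; case/orP: (leq_total #|[set v | side v]| #|[set v | ~~ side v]|) => h.
    exact: W h X1 Y1.
  have E : [set v | ~~ ~~ side v] = [set v | side v] by apply/setP => v; rewrite !inE negbK.
  have [||| x1 [x2 [y1 [y2 [[a1 a2 a3 a4] [b1 b2 b3 b4]]]]]] := W (fun v => ~~ side v);
    rewrite ?E //.
  exists x2, x1, y2, y1; rewrite !negbK in a3 a4.
  by split; split; rewrite // adj_sym.
set X := [set v | side v] in XY *; set Y := [set v | ~~ side v] in XY *.
move=> X1 Y1; have cT := card_sides side.
have dXY (A B : {set T}) x : x \in A -> (forall y, (y \in A) || (y \in B)) ->
    #|T| + 2 <= 2 * nbrs_in adj B x + 2 * #|A|.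
  move=> xA AB; have := deg_nbrs_in adj x AB; have := dg x.
  have : nbrs_in adj A x < #|A|.
    apply: proper_card; rewrite properE; apply/andP; split.
      by apply/subsetP => y; rewrite !inE => /andP[].
    by apply/subsetPn; exists x; rewrite // !inE adj_irr andbF.
  by clear; lia.
have allX y : (y \in X) || (y \in Y) by rewrite !inE orbN.
have allY y : (y \in Y) || (y \in X) by rewrite orbC.
have [x1 x1X] : exists x1, x1 \in X by apply/card_gt0P/ltnW.
have [y1] : exists y1, y1 \in X :\ x1.
  by apply/card_gt0P; move: X1; rewrite (cardsD1 x1) x1X.
rewrite 2!inE => /andP[y1x1 y1X].
have nb x : x \in X -> exists y, y \in [set y in Y | adj x y].
  move=> xX; apply/card_gt0P; have := dXY X Y x xX allX.
  by rewrite /nbrs_in; move: XY cT; rewrite -/X -/Y; clear; lia.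
have [x2] := nb _ x1X; rewrite !inE => /andP[x2Y x12].
have [y2] := nb _ y1X; rewrite !inE => /andP[y2Y y12].
rewrite inE in x1X; rewrite inE in y1X.
have [E|y2x2] := eqVneq y2 x2; last first.
  by exists x1, x2, y1, y2; split; split; rewrite // eq_sym.
subst y2.
have [/existsP[z /and3P[zY y1z zx2]]|noz] := boolP [exists z, [&& z \in Y, adj y1 z & z != x2]].
  rewrite inE in zY; exists x1, x2, y1, z; split; split=> //; by rewrite eq_sym.
(* A single neighbour across forces the classes to have equal size, so vertices of [Y] have
   neighbours across too; any [z] in [Y] other than [x2] then gives a second edge. *)
have ny1 : nbrs_in adj Y y1 <= 1.
  rewrite -(cards1 x2); apply: subset_leq_card; apply/subsetP => z.
  rewrite in_set in_set1 => /andP[zY y1z]; apply: contraR noz => zx2.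
  by apply/existsP; exists z; rewrite zY y1z.
have [z] : exists z, z \in Y :\ x2.
  by apply/card_gt0P; move: Y1; rewrite (cardsD1 x2) inE x2Y.
rewrite 2!inE => /andP[zx2 zY].
have [u] : exists u, u \in [set u in X | adj z u].
  apply/card_gt0P; have := dXY Y X z zY allY; have := dXY X Y y1; rewrite inE => /(_ y1X allX).
  by move: cT ny1; rewrite /nbrs_in -/X -/Y; clear; lia.
rewrite !inE => /andP[uX zu]; rewrite inE in zY.
have [E|ux1] := eqVneq u x1.
  by subst u; exists x1, z, y1, x2; split; split; rewrite // 1?eq_sym // adj_sym.
by exists x1, x2, u, z; split; split; rewrite // 1?eq_sym // adj_sym.
Qed.

Lemma card_switch_le (T : finType) (side : T -> bool) (W : {set T}) :
  #|[set v | side v (+) (v \in W)]| <= #|[set v | side v]| + #|W|.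
Proof.
apply: leq_card_setU; apply/subsetP => v; rewrite !inE.
by case: (v \in W); rewrite ?orbT // addbF => ->.
Qed.

Lemma card_switch_leN (T : finType) (side : T -> bool) (W : {set T}) :
  #|[set v | ~~ (side v (+) (v \in W))]| <= #|[set v | ~~ side v]| + #|W|.
Proof.
apply: leq_card_setU; apply/subsetP => v; rewrite !inE.
by case: (v \in W); rewrite ?orbT // addbF => ->.
Qed.

Lemma good_side_cases (T : finType) (side : T -> bool) b v :
  [set u | good side b v u] = [set u | side u] \/
  [set u | good side b v u] = [set u | ~~ side u].
Proof.
case: (boolP (side v (+) b)) => h; [left|right]; apply/setP => u; rewrite !inE /good;
  by case: (side v) (side u) b h => [] [] [].
Qed.

(** * Compatible Hamilton cycles from a nearly extremal partition *)

Section Cases.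
Variables (T : finType) (adj : rel T) (F : T -> rel T) (D : nat).
Hypothesis adj_sym : symmetric adj.
Hypothesis adj_irr : irreflexive adj.
Hypothesis dg : forall v, #|T| <= 2 * deg adj v.
Hypothesis Fsys : incompat_system adj F.
Hypothesis F_bound : forall v x, #|[set y | F v x y]| <= D.
Hypothesis T_large : 100 * 100 <= #|T|.
Hypothesis D_small : 100 * 100 * D <= #|T|.

Lemma two_cliques_case (side : T -> bool) :
  499 * #|T| <= 1000 * #|[set v | side v]| ->
  499 * #|T| <= 1000 * #|[set v | ~~ side v]| ->
  50 * 50 * nonadj adj side false <= #|T| * #|T| ->
  exists s, hamilton_cycle adj s /\ compatible_cycle F s.
Proof.
move=> sX sY nN; have [|W] := @reassign T adj side false dg.
  by move=> v; have [->|->] := good_side_cases side false v.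
set side' := fun v => _ => -[cW dW nW].
(* [374 * 2500 / 1000 = 935]. *)
have hW : 935 * #|W| <= #|T|.
  have T0 : 0 < #|T| by clear -T_large; lia.
  rewrite -(leq_pmul2r T0); move: cW nN; move: (nonadj _ _ _) #|W| #|T|; clear; lia.
have cT := card_sides side; have cT' := card_sides side'.
have := card_switch_le side W; have := card_switch_leN side W; rewrite -/side' => s1 s2.
have [||x1 [x2 [y1 [y2 [[sx1 sy1 sx2 sy2] [xy1 xy2 a1 a2]]]]]] :=
  @disjoint_crossing_edges T adj side' adj_sym adj_irr dg.
- by move: T_large sX sY hW s1 s2 cT cT'; move: #|T| #|W|;
  move: #|[set v | side v]| #|[set v | ~~ side v]|;
  move: #|[set v | side' v]| #|[set v | ~~ side' v]|; clear; lia.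
- by move: T_large sX sY hW s1 s2 cT cT'; move: #|T| #|W|;
  move: #|[set v | side v]| #|[set v | ~~ side v]|;
  move: #|[set v | side' v]| #|[set v | ~~ side' v]|; clear; lia.
have [s0 [us0 sT0 cs0]] := two_cliques_arrangement sx1 sy1 sx2 sy2 xy1 xy2.
(* [L] is about [n / 9], below [n / 8 - n / 935], for [n = #|T|]. Its square, about [0.0123 n^2],
   exceeds [3 (1/2500 + 2/935) + 33/10000], about [0.0109], times [n^2]. *)
have [L [L1 L2]] : exists L, 9 * L <= #|T| /\ #|T| < 9 * L + 9.
  exists (#|T| %/ 9); split; first by rewrite mulnC leq_trunc_div.
  by rewrite addnC -mulnS [X in _ < X]mulnC ltn_ceil.
apply: (@compatible_from_matching T adj F side' false [:: (x1, x2); (y1, y2)]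
   (nonadj adj side' false) D L s0) => //.
- rewrite /= !inE !negb_or xy1 !andbT.
  have ne x y : side' x -> ~~ side' y -> x != y by move=> sx; apply: contra => /eqP <-.
  by rewrite (eq_sym x2 y1) (ne x1 x2) // (ne x1 y2) // (ne y1 x2) // (ne y1 y2) // xy2.
- by move=> e; rewrite !inE => /orP[] /eqP ->.
- move=> v; move: (dW v) L1 hW T_large; clear L2; rewrite [2 * _]/=.
  by move: (gdeg _ _ _ _) L #|W| #|T|; clear; lia.
- by clear -T_large; lia.
have h1 : 935 * (#|W| * #|T|) <= #|T| * #|T| by rewrite mulnA leq_mul2r hW orbT.
have h2 : 100 * 100 * (#|T| * D) <= #|T| * #|T|.
  by rewrite mulnCA leq_mul2l D_small orbT.
have h3 : 100 * 100 * #|T| <= #|T| * #|T| by rewrite leq_mul2r T_large orbT.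
have h4 : #|T| * #|T| <= (9 * L + 8) * (9 * L + 8) by apply: leq_mul; rewrite -ltnS -addnS.
move: nN nW h1 h2 h3 h4 L1 L2 T_large; rewrite (mulnC #|W|).
move: (#|T| * #|W|) (#|T| * D) (nonadj _ _ _) (nonadj _ _ _) L #|T|.
clear; lia.
Qed.

Lemma near_bipartite_case (side : T -> bool) :
  50 * 100 * #|[set v | side v]| <= 50 * 100 * #|[set v | ~~ side v]| + #|T| ->
  50 * 100 * #|[set v | ~~ side v]| <= 50 * 100 * #|[set v | side v]| + #|T| ->
  40 * 100 * nonadj adj side true <= #|T| * #|T| ->
  exists s, hamilton_cycle adj s /\ compatible_cycle F s.
Proof.
move=> sX sY nN; have cT := card_sides side; have [|W] := @reassign T adj side true dg.
  move=> v; have [->|->] := good_side_cases side true v; move: sX sY cT;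
    by move: #|T| #|[set v | side v]| #|[set v | ~~ side v]|; clear; lia.
set side' := fun v => _ => -[cW dW nW].
have hW : 1496 * #|W| <= #|T|.
  have T0 : 0 < #|T| by clear -T_large; lia.
  rewrite -(leq_pmul2r T0); move: cW nN; move: (nonadj _ _ _) #|W| #|T|; clear; lia.
(* Exchanging the names of the sides does not affect [good], so the class [side1] may be taken to be
   the larger one. *)
have [side1 [XY sXY d1 n1]] : exists side1 : T -> bool,
    [/\ #|[set v | ~~ side1 v]| <= #|[set v | side1 v]|,
      50 * 100 * #|[set v | side1 v]| <= 50 * 100 * (#|[set v | ~~ side1 v]| + 2 * #|W|) + #|T|,
      forall v, #|T| <= 8 * (gdeg adj side1 true v + #|W|) &
      nonadj adj side1 true <= nonadj adj side true + 2 * (#|T| * #|W|)].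
  have cT' := card_sides side'.
  have := card_switch_le side W; have := card_switch_leN side W; rewrite -/side' => s1 s2.
  case: (leqP #|[set v | ~~ side' v]| #|[set v | side' v]|) => XY.
    exists side'; split => //; move: sX sY cT cT' s1 s2.
    move: #|[set v | side' v]| #|[set v | ~~ side' v]| #|T|.
    by move: #|W| #|[set v | side v]| #|[set v | ~~ side v]|; clear; lia.
  have E : [set v | ~~ ~~ side' v] = [set v | side' v] by apply/setP => v; rewrite !inE negbK.
  have gE x y : good (fun v => ~~ side' v) true x y = good side' true x y.
    by rewrite /good; case: (side' x) (side' y) => [] [].
  exists (fun v => ~~ side' v); rewrite E; split; first exact: ltnW.
  - move: sX sY cT cT' s1 s2; clear XY.
    move: #|[set v | side' v]| #|[set v | ~~ side' v]| #|T|.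
    by move: #|W| #|[set v | side v]| #|[set v | ~~ side v]|; clear; lia.
  - move=> v; suff -> : gdeg adj (fun v => ~~ side' v) true v = gdeg adj side' true v by [].
    by apply: eq_card => u; rewrite !inE gE.
  - suff -> : nonadj adj (fun v => ~~ side' v) true = nonadj adj side' true by [].
    by apply: eq_card => u; rewrite !inE gE.
clear dW nW cW sX sY cT side'.
pose k := #|[set v | side1 v]| - #|[set v | ~~ side1 v]|.
have kE : #|[set v | side1 v]| = #|[set v | ~~ side1 v]| + k by rewrite subnKC.
clearbody k; have cT1 := card_sides side1.
have hk : 50 * 100 * k <= 100 * 100 * #|W| + #|T|.
  move: sXY; rewrite kE; move: #|T| #|W| #|[set v | ~~ side1 v]|; clear; lia.
(* [0.124 n] lies just below the degree bound [n / 8 - n / 1496]. The surplus [k] is at most about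
   [0.0016 n], so after losing [k] in [balance] and [2 k] to the matching at least [L], about
   [2 n / 17], remains. *)
have [L0 [L01 L02]] : exists L, 250 * L <= 31 * #|T| /\ 31 * #|T| < 250 * L + 250.
  exists (31 * #|T| %/ 250); split; first by rewrite mulnC leq_trunc_div.
  by rewrite addnC -mulnS [X in _ < X]mulnC ltn_ceil.
have [L [L1 L2]] : exists L, 17 * L <= 2 * #|T| /\ 2 * #|T| < 17 * L + 17.
  exists (2 * #|T| %/ 17); split; first by rewrite mulnC leq_trunc_div.
  by rewrite addnC -mulnS [X in _ < X]mulnC ltn_ceil.
have [||side2 [ms [[m1 m2 m3 m4] [c2 d2 n2]]]] := balance adj_sym adj_irr dg (L := L0) kE.
- move: L01 hk hW cT1; rewrite kE; clear; move: #|T| #|W| #|[set v | ~~ side1 v]|; lia.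
- move=> v; move: L01 (d1 v) hW; clear; move: (gdeg _ _ _ _) #|T| #|W|; lia.
have T0 : 0 < #|T| by move: T_large; clear; move: #|T|; lia.
have [s0 [us0 sT0 cs0]] := bipartite_arrangement m2 m4 T0 c2.
apply: (@compatible_from_matching T adj F side2 true ms (nonadj adj side2 true) D L s0) => //.
- move=> v; move: L1 L02 (d2 v) hW hk m1 T_large; clear.
  by move: (gdeg _ _ _ _) (size ms) #|T| #|W|; lia.
- by move: T_large; clear; move: #|T|; lia.
have h1 : 1496 * (#|T| * #|W|) <= #|T| * #|T| by rewrite mulnCA leq_mul2l hW orbT.
have h2 : 100 * 100 * (#|T| * D) <= #|T| * #|T|.
  by rewrite mulnCA leq_mul2l D_small orbT.
have h3 : 100 * 100 * #|T| <= #|T| * #|T| by rewrite leq_mul2r T_large orbT.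
have h4 : (2 * #|T|) * (2 * #|T|) <= (17 * L + 16) * (17 * L + 16).
  by apply: leq_mul; rewrite -ltnS -addnS.
have h5 : 50 * 100 * (#|T| * k) <= 100 * 100 * (#|T| * #|W|) + #|T| * #|T|.
  by rewrite !(mulnCA _ #|T|) -mulnDr leq_mul2l hk orbT.
move: nN n1 n2 h1 h2 h3 h4 h5 L1 L2 T_large.
clear; move: (#|T| * #|W|) (#|T| * D) (#|T| * k) (nonadj _ _ _) (nonadj _ _ _) (nonadj _ _ _) #|T|.
lia.
Qed.
End Cases.

(** * The two extremal structures *)

Section Extremal.
Variables (T : finType) (adj : rel T) (F : T -> rel T) (D : nat) (A B : {set T}).
Hypothesis adj_sym : symmetric adj.
Hypothesis adj_irr : irreflexive adj.
Hypothesis dg : forall v, #|T| <= 2 * deg adj v.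
Hypothesis Fsys : incompat_system adj F.
Hypothesis F_bound : forall v x, #|[set y | F v x y]| <= D.
Hypothesis T_large : 100 * 100 <= #|T|.
Hypothesis D_small : 100 * 100 * D <= #|T|.
Hypothesis A_large : 50 * 1000 * #|T| <= 100 * 1000 * #|A| + #|T|.
Hypothesis B_large : 50 * 1000 * #|T| <= 100 * 1000 * #|B| + #|T|.
Hypothesis AB_sparse : 60 * 1000 * e_between adj A B <= #|T| * #|T|.

(** Minimum degree turns few neighbours outside [S] into few non-neighbours inside [S]. *)
Lemma nonadj_row (S : {set T}) v :
  2 * #|[set u | (u \in S) && ~~ adj v u]| + #|T| <= 2 * #|S| + 2 * nbrs_in adj (~: S) v.
Proof.
have h := @deg_nbrs_in T adj S (~: S) v.
have all y : (y \in S) || (y \in ~: S) by rewrite inE orbN.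
have cS : #|[set u | (u \in S) && ~~ adj v u]| + nbrs_in adj S v = #|S|.
  rewrite -[RHS](cardsID [set u | adj v u] S) addnC /nbrs_in.
  by congr (_ + _); apply: eq_card => u; rewrite !inE // andbC.
move: (dg v) (h all) cS; move: #|T| #|S| #|[set u | (u \in S) && ~~ adj v u]|.
move: (nbrs_in _ _ _) (nbrs_in _ _ _) (deg _ _); clear; lia.
Qed.

Lemma nonadj_rows (S R : {set T}) :
  2 * (\sum_(v in R) #|[set u | (u \in S) && ~~ adj v u]|) + #|R| * #|T| <=
  2 * (#|R| * #|S|) + 2 * e_between adj R (~: S).
Proof.
rewrite e_betweenE !big_distrr -!sum_nat_const /= big_distrr /= -!big_split /=.
by apply: leq_sum => v _; apply: nonadj_row.
Qed.

Let C := A :&: B.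
Let O := ~: (A :|: B).

Let card_AB : #|A| + #|B| + #|O| = #|T| + #|C|.
Proof. by rewrite -(cardsC (A :|: B)) -cardsUI addnAC. Qed.

(** A vertex of [C] has at least half of all vertices as neighbours, each in [A], [B] or [O], and
    the pairs from [C] to [A] and from [C] to [B] are each bounded by [e_between adj A B]. *)
Lemma intersection_size :
  #|C| * #|T| <= 4 * e_between adj A B + 2 * (#|C| * #|O|).
Proof.
have hB : \sum_(v in C) nbrs_in adj B v <= e_between adj A B.
  rewrite e_betweenE [X in _ <= X](bigID (mem B)) /=.
  apply: leq_trans (leq_addr _ _); rewrite (eq_bigl (fun v => (v \in A) && (v \in B))) //.
  by move=> v; rewrite inE.
have hA : \sum_(v in C) nbrs_in adj A v <= e_between adj A B.
  rewrite e_between_sym // e_betweenE [X in _ <= X](bigID (mem A)) /=.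
  apply: leq_trans (leq_addr _ _); rewrite (eq_bigl (fun v => (v \in B) && (v \in A))) //.
  by move=> v; rewrite inE andbC.
have : \sum_(v in C) #|T| <= \sum_(v in C) (2 * (nbrs_in adj A v + nbrs_in adj B v + #|O|)).
  apply: leq_sum => v _; apply: leq_trans (dg v) _; rewrite leq_mul2l /=.
  have := @deg_nbrs_in T adj (A :|: B) O v => /(_ (fun y => _)) h.
  apply: leq_trans (h _) _; first by move=> y; rewrite [y \in O]inE orbN.
  apply: leq_add (nbrs_in_le _ _ _); apply: leq_card_setU.
  by apply/subsetP => y; rewrite !inE => /andP[/orP[]-> ->]; rewrite ?orbT.
rewrite -big_distrr /= !big_split /= !sum_nat_const; clear -hA hB; lia.
Qed.

(** Since [#|O|] is at most about [#|C|], the ratio [x] of [#|C|] to [#|T|] satisfies a bound on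
    [x (1 - 2 x)] by a small constant, so it is near 0 or near 1/2. *)
Lemma intersection_dichotomy :
  100 * 100 * #|C| <= #|T| \/ 50 * 100 * #|T| <= 100 * 100 * #|C| + #|T|.
Proof.
have := intersection_size; move: card_AB A_large B_large AB_sparse T_large.
move: #|A| #|B| #|C| #|O| #|T| (e_between _ _ _); clear => a b i o n e h hA hB hE hn hi.
case: (leqP (100 * 100 * i) n) => h1; first by left.
case: (leqP (50 * 100 * n) (100 * 100 * i + n)) => h2; [by right | exfalso].
have h3 : 100 * 1000 * o <= 100 * 1000 * i + 2 * n by lia.
have h4 : 100 * 1000 * (i * o) <= 100 * 1000 * (i * i) + 2 * (i * n).
  by have := leq_mul (leqnn i) h3; lia.
nia.
Qed.

Lemma nonadj_split (S : {set T}) b :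
  nonadj adj (fun v => v \in S) b =
  \sum_(v in S) #|[set u | (u \in if b then ~: S else S) && ~~ adj v u]| +
  \sum_(v in ~: S) #|[set u | (u \in if b then S else ~: S) && ~~ adj v u]|.
Proof.
rewrite /nonadj (card_pairsE (fun x y => good (fun v => v \in S) b x y && ~~ adj x y)).
rewrite (bigID (mem S)) /=; congr (_ + _).
  apply: eq_bigr => v vS; apply: eq_card => u; rewrite !inE /good vS.
  by case: b; rewrite ?inE; case: (u \in S).
rewrite (eq_bigl (fun v => v \in ~: S)); last by move=> v; rewrite !inE.
apply: eq_bigr => v; rewrite [v \in ~: S]in_setC => vS; apply: eq_card => u;
  rewrite !inE /good (negbTE vS).
by case: b; rewrite ?inE; case: (u \in S).
Qed.

Lemma nonadj_e_between (S R : {set T}) :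
  \sum_(v in R) #|[set u | (u \in S) && ~~ adj v u]| = e_between (fun x y => ~~ adj x y) R S.
Proof. by rewrite e_betweenE. Qed.

(** The complement of [A] lies in the union of [B] and the small set [O], so few edges leave [A],
    and [A] and its complement are both nearly complete. *)
Lemma disjoint_case : 100 * 100 * #|C| <= #|T| ->
  exists s, hamilton_cycle adj s /\ compatible_cycle F s.
Proof.
move=> hC; have E : [set v | v \in A] = A by apply/setP => v; rewrite inE.
have EC : [set v | v \notin A] = ~: A by apply/setP => v; rewrite !inE.
have cA := cardsC A.
have hO : 100 * 1000 * #|O| <= 100 * 1000 * #|C| + 2 * #|T|.
  move: card_AB A_large B_large; move: #|A| #|B| #|C| #|O| #|T|; clear; lia.
have hcut : e_between adj A (~: A) <= e_between adj A B + #|A| * #|O|.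
  rewrite !e_betweenE -sum_nat_const -big_split /=; apply: leq_sum => v _.
  apply: leq_card_setU; apply/subsetP => u; rewrite !inE => /andP[uA ->].
  by rewrite (negbTE uA) /= andbT orbN.
have bigA : 499 * #|T| <= 1000 * #|A| by move: A_large; move: #|A| #|T|; clear; lia.
have bigA' : 499 * #|T| <= 1000 * #|~: A|.
  move: cA card_AB B_large hC hO; move: #|~: A| #|A| #|B| #|C| #|O| #|T|; clear; lia.
apply: (@two_cliques_case T adj F D adj_sym adj_irr dg Fsys F_bound T_large D_small
  (fun v => v \in A)).
- by rewrite E.
- by rewrite EC.
rewrite nonadj_split; have h1 := nonadj_rows A A; have := nonadj_rows (~: A) (~: A).
rewrite setCK (e_between_sym (~: A)) // => h2.
have h3 : 100 * 100 * (#|C| * #|T|) <= #|T| * #|T| by rewrite mulnA leq_mul2r hC orbT.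
have h4 : 100 * 1000 * (#|A| * #|O|) <= 100 * 1000 * (#|C| * #|T|) + 2 * (#|T| * #|T|).
  apply: leq_trans (_ : #|T| * (100 * 1000 * #|C| + 2 * #|T|) <= _).
    by rewrite mulnCA; apply: leq_mul => //; rewrite -cA leq_addr.
  by clear; move: #|T| #|C|; lia.
move: h1 h2 h3 h4 hcut AB_sparse hC cA A_large card_AB B_large.
move: (e_between adj A B) (e_between adj A (~: A)) (#|A| * #|O|).
move: (\sum_(v in A) _) (\sum_(v in ~: A) _).
move: #|~: A| #|A| #|B| #|C| #|T| #|O|; clear.
move=> a' a b i n o N1 N2 ao e' e h1 h2 h3 h4 h5 h6 h7 h8 h9 h10 h11.
nia.
Qed.

(** [C] spans few edges because [e_between adj C C] is at most [e_between adj A B]; hence almost all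
    pairs between [C] and its complement are edges. *)
Lemma nested_case : 50 * 100 * #|T| <= 100 * 100 * #|C| + #|T| ->
  exists s, hamilton_cycle adj s /\ compatible_cycle F s.
Proof.
move=> hC; have E : [set v | v \in C] = C by apply/setP => v; rewrite inE.
have EC : [set v | v \notin C] = ~: C by apply/setP => v; rewrite !inE.
have cC := cardsC C.
have hcut : e_between adj C C <= e_between adj A B.
  rewrite !e_betweenE [X in _ <= X](bigID (mem B)) /=.
  apply: leq_trans (leq_addr _ _).
  rewrite [X in _ <= X](eq_bigl (mem C)); last by move=> v; rewrite !inE.
  by apply: leq_sum => v _; apply: nbrs_inS; apply: subsetIr.
have := nonadj_rows (~: C) C; rewrite setCK => h1.
(* The number of non-edges bounded in [h1] is nonnegative, which keeps the complement of [C] from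
   being much smaller than half. *)
have up : 50 * 100 * #|C| <= 50 * 100 * #|~: C| + #|T|.
  move: h1 hcut AB_sparse hC cC T_large; move: (e_between adj C C) (e_between adj A B).
  move: (\sum_(v in C) _) #|C| #|~: C| #|T|; clear => N i i' n e1 e h1 h2 h3 h4 h5 h6.
  nia.
apply: (@near_bipartite_case T adj F D adj_sym adj_irr dg Fsys F_bound T_large D_small
  (fun v => v \in C)).
- by rewrite E EC.
- by rewrite E EC; move: hC cC; move: #|C| #|~: C| #|T|; clear; lia.
rewrite nonadj_split (nonadj_e_between C (~: C)) e_between_sym; last by move=> x y; rewrite adj_sym.
rewrite -nonadj_e_between; move: h1 hcut AB_sparse hC cC up.
move: (e_between adj C C) (e_between adj A B).
move: (\sum_(v in C) _) #|C| #|~: C| #|T|; clear => N i i' n e1 e h1 h2 h3 h4 h5 h6.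
nia.
Qed.

Theorem extremal_case : exists s, hamilton_cycle adj s /\ compatible_cycle F s.
Proof.
by case: intersection_dichotomy => h; [apply: disjoint_case | apply: nested_case].
Qed.
End Extremal.

Lemma e_between_lower (T : finType) (adj : rel T) (A B : {set T}) :
  (forall v, #|T| <= 2 * deg adj v) ->
  2 * (#|A| * #|B|) <= 2 * e_between adj A B + #|A| * #|T|.
Proof.
move=> dg; rewrite e_betweenE big_distrr -!sum_nat_const /= big_distrr /= -big_split /=.
apply: leq_sum => x _; have := @deg_nbrs_in T adj B (~: B) x.
have all y : (y \in B) || (y \in ~: B) by rewrite inE orbN.
move=> /(_ all); move: (dg x) (nbrs_in_le adj (~: B) x) (cardsC B).
move: (nbrs_in adj B x) (nbrs_in adj (~: B) x) (deg adj x) #|B| #|~: B| #|T|; clear; lia.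
Qed.

Local Open Scope ring_scope.

(** * Numerical consequences of the hypothesis on the parameters *)

Section Constants.
Variables (R : realType) (mu nu eta n a b e : R).
Hypothesis constants : 110 * nu + 250 * eta + 10 * Num.sqrt mu < 1 / 2000.
Hypothesis n_gt0 : 0 < n.
Hypothesis a_large : (1 / 2 - nu) * n <= a.
Hypothesis b_large : (1 / 2 - nu) * n <= b.
Hypothesis e_ge0 : 0 <= e.
Hypothesis e_small : e <= eta * n ^+ 2.
Hypothesis e_lower : 2 * (a * b) <= 2 * e + a * n.

Lemma eta_ge0 : 0 <= eta.
Proof.
have n2 : 0 < n ^+ 2 by rewrite exprn_gt0.
by rewrite -(pmulr_lge0 _ n2); apply: le_trans e_ge0 e_small.
Qed.

(* For [nu < 0] this uses e(A, B) >= |A| (|B| - n / 2). *)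
Lemma eta_ge_nu : 0 <= nu + 2 * eta.
Proof.
have [nu0|nu0] := leP 0 nu; first by have := eta_ge0; lra.
have n2 : 0 < n ^+ 2 by rewrite exprn_gt0.
have h1 : (1 / 2 - nu) * n * (- nu * n) <= a * (b - n / 2).
  apply: ler_pM => //.
  - by apply: mulr_ge0; [lra | exact: ltW].
  - by apply: mulr_ge0; [lra | exact: ltW].
  - by move: b_large; lra.
rewrite -(pmulr_lge0 _ n2).
have h2 : - nu / 2 * n ^+ 2 <= (1 / 2 - nu) * n * (- nu * n).
  have : 0 <= nu ^+ 2 * n ^+ 2 by rewrite mulr_ge0 // sqr_ge0.
  lra.
have h3 := le_trans h2 h1; move: e_lower e_small h3; lra.
Qed.

(** From [nu >= - 2 * eta] follows [110 * nu + 250 * eta >= 30 * eta >= 0], which bounds [eta] and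
    [Num.sqrt mu]; the bound on [nu] needs only [eta >= 0]. *)
Lemma parameter_bounds :
  [/\ eta < 1 / (60 * 1000), nu < 1 / (220 * 1000) & Num.sqrt mu < 1 / (20 * 1000)].
Proof.
move: eta_ge0 eta_ge_nu (sqrtr_ge0 mu) constants; move: (Num.sqrt mu) => s h1 h2 h3 h4.
by split; lra.
Qed.
End Constants.

Lemma class_large (R : realType) (nu : R) (n a : nat) :
  (1 / 2 - nu) * n%:R <= a%:R -> nu * n%:R <= 1 / (220 * 1000) * n%:R ->
  (50 * 1000 * n <= 100 * 1000 * a + n)%N.
Proof.
rewrite -(ler_nat R) natrD !natrM; have := ler0n R n.
by move: (n%:R : R) (a%:R : R) => x y; lra.
Qed.

Theorem theorem3p2 (R : realType) (mu nu eta : R)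
  (T : finType) (adj : rel T) (F : T -> rel T) (A B : {set T}) :
  0 < mu ->
  110 * nu + 250 * eta + 10 * Num.sqrt mu < 1 / 2000 ->
  simple_graph adj ->
  (3 <= #|T|)%N ->
  (forall v : T, (#|T|%:R / 2 : R) <= (deg adj v)%:R) ->
  incompat_system adj F ->
  bounded_system adj F (mu * #|T|%:R) ->
  (1 / 2 - nu) * #|T|%:R <= #|A|%:R ->
  (1 / 2 - nu) * #|T|%:R <= #|B|%:R ->
  (e_between adj A B)%:R <= eta * (#|T|%:R ^+ 2) ->
  exists s : seq T, hamilton_cycle adj s /\ compatible_cycle F s.
Proof.
move=> mu0 hc [adj_sym adj_irr] T3 dgR Fsys Fb hA hB hE.
have dg v : (#|T| <= 2 * deg adj v)%N.
  by rewrite -(ler_nat R) natrM; have := dgR v; lra.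
(* Below 1 the bound forces [F] to be empty. Otherwise the smallness of [mu] makes [#|T|] large
   enough for the extremal argument. *)
have [muT|muT] := ltP (mu * #|T|%:R) 1.
  have [s hs] := dirac adj_sym adj_irr T3 dg; exists s; split => // v x y _ _.
  apply/negP => Fxy; have [/Fb h _ _ _] := Fsys _ _ _ Fxy.
  have := le_lt_trans h muT; rewrite -[1]/(1%:R) ltr_nat ltnS leqn0 cards_eq0 => /eqP E.
  by have := in_set0 y; rewrite -E inE Fxy.
have n0 : 0 < #|T|%:R :> R by rewrite ltr0n; apply: leq_trans T3.
have el := e_between_lower A B dg; rewrite -(ler_nat R) natrD !natrM in el.
have [heta hnu hmu] := parameter_bounds hc n0 hA hB (ler0n _ _) hE el.
have mu_small : mu < 1 / (20 * 1000) ^+ 2.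
  rewrite -(sqr_sqrtr (ltW mu0)) expr2; have := sqrtr_ge0 mu; nra.
have muT2 : mu * #|T|%:R <= 1 / (20 * 1000) ^+ 2 * #|T|%:R by rewrite ler_pM2r // ltW.
have nuT : nu * #|T|%:R <= 1 / (220 * 1000) * #|T|%:R by rewrite ler_pM2r // ltW.
have etaT : eta * #|T|%:R ^+ 2 <= 1 / (60 * 1000) * #|T|%:R ^+ 2.
  by rewrite ler_pM2r ?exprn_gt0 // ltW.
clear el heta hnu hmu mu_small hc.
(* The integer bound [#|T| %/ (100 * 100)] is ample, as [mu * #|T|] is at most [#|T|] over
   [(20 * 1000) ^ 2]. *)
apply: (@extremal_case T adj F (#|T| %/ (100 * 100))%N A B) => //.
- move=> v x; rewrite leq_divRL // -(ler_nat R) !natrM.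
  have [/Fb|nvx] := boolP (adj v x); first by move: muT2 n0; clear; lra.
  rewrite (_ : [set _ | _] = set0) ?cards0 ?mul0r ?ler0n //.
  by apply/setP => y; rewrite !inE; apply/negP => /Fsys[]; rewrite (negbTE nvx).
- by rewrite -(ler_nat R) natrM; move: muT muT2; clear; lra.
- by rewrite mulnC leq_trunc_div.
- exact: class_large hA nuT.
- exact: class_large hB nuT.
rewrite -(ler_nat R) !natrM; move: hE etaT.
by move: (_%:R : R) (#|T|%:R : R) => x y; clear; lra.
Qed.
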